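(* Assume $\frac{\alpha}{\mathsf p}+\frac{\gamma}{\mathsf q}=1$, set $\rho=\alpha/\mathsf p$, let $n\ge1$ and fix an initial state $\eta\in\{0,1\}^{\mathbb Z_{>0}}$ with finitely many particles. Suppose $u:\mathbb R_+\times\mathbb Z_{\ge0}^n\to\mathbb R$ satisfies: (1) for all $\vec x\in\mathbb Z_{\ge1}^n$ and $t\in\mathbb R_+$, $\frac{d}{dt}u(t;\vec x)=\Delta^{\mathsf p,\mathsf q}u(t;\vec x)$; (2) for all $t\in\mathbb R_+$, all $i\in\{1,\dots,n-1\}$ and all $\vec x\in\mathbb Z_{\ge1}^n$ such that $x_{i+1}=x_i+1$, $$\mathsf p\,u(t;\vec x_{i+1}^-)+\mathsf q\,u(t;\vec x_i^+)=(\mathsf p+\mathsf q)\,u(t;\vec x);$$ (3) for all $t\in\mathbb R_+$ and all integers $2\le x_2<\dots<x_n$, $u(t;0,x_2,\dots,x_n)=(\rho q+1-\rho)\,u(t;1,x_2,\dots,x_n)$; (4) for any $T>0$ there exist constants $c,C>0$ such that for all $t\in[0,T]$ and $\vec x\in\mathbb W^n_{\ge1}$, $|u(t;\vec x)|\le C\prod_{i=1}^ne^{c|x_i|}$; (5) for any $\vec x\in\mathbb W^n_{\ge1}$, $u(0;\vec x)=H(\eta,\vec x)$. Then for all $\vec x\in\mathbb W^n_{\ge1}$ and $t\in\mathbb R_+$, $u(t;\vec x)=\mathbb E^\eta[H(\eta(t),\vec x)]$, where $\mathbb E^\eta$ denotes expectation with respect to half-line open ASEP $\eta(t)$ with initial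 condition $\eta$.
   Context: Parameters: real numbers $\mathsf p>\mathsf q>0$ and $\alpha,\gamma\ge0$; $q:=\mathsf q/\mathsf p\in(0,1)$. Half-line open ASEP: the continuous time Markov process $\eta(t)$ on $\{0,1\}^{\mathbb Z_{>0}}$ in which, independently, for each $x\ge1$ a particle jumps from $x$ to $x+1$ at rate $\mathsf p\,\eta_x(1-\eta_{x+1})$ and from $x+1$ to $x$ at rate $\mathsf q\,\eta_{x+1}(1-\eta_x)$, a particle is created at site $1$ at rate $\alpha(1-\eta_1)$ and annihilated at site $1$ at rate $\gamma\eta_1$. $N_x(\eta)=\sum_{i\ge x}\eta_i$, $Q_x(\eta)=q^{N_x(\eta)}$, $H(\eta,\vec x)=\prod_{i=1}^nQ_{x_i}(\eta)$. $\mathbb W^n_{\ge1}=\{\vec x\in\mathbb Z^n:1\le x_1<\dots<x_n\}$, $\vec x_i^{\pm}=(x_1,\dots,x_i\pm1,\dots,x_n)$, and $$\Delta^{\mathsf p,\mathsf q}f(\vec x)=\sum_{i=1}^n\big(\mathsf p f(\vec x_i^-)+\mathsf q f(\vec x_i^+)-(\mathsf p+\mathsf q)f(\vec x)\big).$$ *)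

(* Defs.v *)
From HB Require Import structures.
From mathcomp Require Import all_boot all_order all_algebra.
From mathcomp Require Import all_classical all_reals all_analysis.

Set Implicit Arguments.
Unset Strict Implicit.
Unset Printing Implicit Defensive.

Export Order.TTheory GRing.Theory Num.Theory.
Export numFieldNormedType.Exports.

Local Open Scope classical_set_scope.
Local Open Scope ring_scope.

(* The sites are the positive integers.  A configuration in {0,1}^{Z_{>0}}, with
   its compact product topology, is an element of [cantor_space]; the coordinate
   of index k is the occupation variable of the site k.+1. *)

Notation config := cantor_space.

Definition occ (eta : config) (x : nat) : bool := eta x.-1.

Definition exchange (eta : config) (x y : nat) : config :=
  fun k => if k.+1 == x then occ eta y
           else if k.+1 == y then occ eta x else eta k.

Definition flip (eta : config) (x : nat) : config :=
  fun k => if k.+1 == x then ~~ eta k else eta k.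

Section Observables.
Context {R : realType}.

Definition N_ (x : nat) (eta : config) : \bar R :=
  (\sum_(x <= i <oo) ((occ eta i)%:R : R)%:E)%E.

(* r ^ N_x, with the convention r ^ oo = 0, as 0 < r < 1 *)
Definition Q_ (r : R) (x : nat) (eta : config) : R :=
  if N_ x eta is m%:E then r `^ m else 0.

Definition H_ (r : R) (n : nat) (eta : config) (x : {ffun 'I_n -> nat}) : R :=
  \prod_(i < n) Q_ r (x i) eta.

End Observables.

Section HalfLineASEP.
Context {R : realType}.

(* f depends on finitely many sites *)
Definition local_fun (f : config -> R) : Prop :=
  exists m : nat, forall eta xi : config,
    (forall x, (1 <= x <= m)%N -> occ eta x = occ xi x) -> f eta = f xi.

(* On a local function only finitely many terms of the series are nonzero. *)
Definition asep_gen (p q alpha gamma : R) (f : config -> R) (eta : config) : R :=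
  \big[+%R/0]_(1 <= x <oo)
    (p * ((occ eta x)%:R * (1 - (occ eta x.+1)%:R)) *
       (f (exchange eta x x.+1) - f eta)
     + q * ((occ eta x.+1)%:R * (1 - (occ eta x)%:R)) *
       (f (exchange eta x x.+1) - f eta))
  + alpha * (1 - (occ eta 1)%:R) * (f (flip eta 1) - f eta)
  + gamma * (occ eta 1)%:R * (f (flip eta 1) - f eta).

(* Feller semigroups on the space C of continuous real functions on [config];
   the values of [S] outside C are irrelevant. *)
Record feller_semigroup (S : R -> (config -> R) -> (config -> R)) : Prop := {
  fs_cont : forall (t : R) (f : config -> R), 0 <= t -> continuous f -> continuous (S t f) ;
  fs_linear : forall (t a : R) (f g : config -> R), 0 <= t -> continuous f -> continuous g ->
    S t (fun eta => a * f eta + g eta)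
    = (fun eta => a * S t f eta + S t g eta) ;
  fs_one : forall t : R, 0 <= t -> S t (fun=> 1) = (fun=> 1) ;
  fs_pos : forall (t : R) (f : config -> R), 0 <= t -> continuous f ->
    (forall eta, 0 <= f eta) -> forall eta, 0 <= S t f eta ;
  fs_zero : forall f : config -> R, continuous f -> S 0 f = f ;
  fs_add : forall (s t : R) (f : config -> R), 0 <= s -> 0 <= t -> continuous f ->
    S (s + t) f = S s (S t f) ;
  fs_right_cont : forall (t : R) (f : config -> R), 0 <= t -> continuous f ->
    {uniform, S s f @[s --> t^'+] --> S t f} }.

(* f is in the domain of the infinitesimal generator of S, which maps it to g *)
Definition generates (S : R -> (config -> R) -> (config -> R))
    (f g : config -> R) : Prop :=
  {uniform, (fun eta => h^-1 * (S h f eta - f eta)) @[h --> 0^'+] --> g}.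

(* (f, g) is in the closure, in C * C with the uniform norm, of the graph of
   the operator A restricted to the local functions *)
Definition local_closure (A : (config -> R) -> (config -> R))
    (f g : config -> R) : Prop :=
  exists f_ : nat -> config -> R,
    [/\ (forall k, local_fun (f_ k)),
        {uniform, f_ k @[k --> \oo] --> f} &
        {uniform, A (f_ k) @[k --> \oo] --> g}].

Definition asep_semigroup (p q alpha gamma : R)
    (S : R -> (config -> R) -> (config -> R)) : Prop :=
  feller_semigroup S /\
  forall f g : config -> R, continuous f -> continuous g ->
    generates S f g <-> local_closure (asep_gen p q alpha gamma) f g.

(* The events observable up to time s.  The Borel sigma-algebra of [config] is
   generated by the occupation variables. *)
Definition history d (T : measurableType d) (X : R -> T -> config) (s : R)
    : set (set T) :=
  <<s [set A : set T | exists (r : R) (x : nat),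
        [/\ 0 <= r <= s, (1 <= x)%N & A = [set w | occ (X r w) x]]] >>.

(* X, indexed by the nonnegative times, is half-line open ASEP started from
   eta: the Markov process with right-continuous paths with left limits whose
   semigroup has for generator the closure of [asep_gen]. *)
Record half_line_asep (p q alpha gamma : R) (eta : config)
    d (T : measurableType d) (P : probability T R) (X : R -> T -> config)
    : Prop := {
  hl_meas : forall (t : R) (x : nat), 0 <= t -> (1 <= x)%N ->
    measurable [set w | occ (X t w) x] ;
  hl_init : {ae P, forall w, X 0 w = eta} ;
  hl_rcont : forall (w : T) (t : R), 0 <= t -> X s w @[s --> t^'+] --> X t w ;
  hl_llim : forall (w : T) (t : R), 0 < t -> cvg (X s w @[s --> t^'-]) ;
  hl_markov : exists2 S, asep_semigroup p q alpha gamma S &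
    forall (s t : R) (f : config -> R) (A : set T),
      0 <= s -> 0 <= t -> continuous f -> history X s A ->
      (\int[P]_(w in A) (f (X (s + t) w))%:E
       = \int[P]_(w in A) (S t f (X s w))%:E)%E }.

End HalfLineASEP.

Section Lattice.
Context {R : realType}.

(* Points of Z_{>=0}^n; truncation in [shift_m] does not matter where x i >= 1. *)
Definition upd n (x : {ffun 'I_n -> nat}) (i : 'I_n) (k : nat) :
    {ffun 'I_n -> nat} :=
  [ffun j => if j == i then k else x j].

Definition shift_m n (x : {ffun 'I_n -> nat}) (i : 'I_n) := upd x i (x i).-1.
Definition shift_p n (x : {ffun 'I_n -> nat}) (i : 'I_n) := upd x i (x i).+1.

Definition weyl n (x : {ffun 'I_n -> nat}) : Prop :=
  (forall i, (1 <= x i)%N) /\ (forall i j : 'I_n, (i < j)%N -> (x i < x j)%N).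

Definition Delta (p q : R) n (f : {ffun 'I_n -> nat} -> R)
    (x : {ffun 'I_n -> nat}) : R :=
  \sum_(i < n) (p * f (shift_m x i) + q * f (shift_p x i) - (p + q) * f x).

(* the derivative of g at t relative to [0, +oo[: one-sided at t = 0 *)
Definition has_deriv_ge0 (g : R -> R) (t l : R) : Prop :=
  (g s - g t) / (s - t) @[s --> within [set s | 0 <= s] t^'] --> l.

End Lattice.

(* Main.v *)
Require Import Defs.
From mathcomp Require Import all_boot all_order all_algebra.
From mathcomp Require Import all_classical all_reals all_analysis.
From mathcomp Require Import ring lra zify.

Set Implicit Arguments.
Unset Strict Implicit.
Unset Printing Implicit Defensive.

Local Open Scope classical_set_scope.
Local Open Scope ring_scope.

(* Truncating N_x to the sites up to M turns H into local functions H^M, which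
   satisfy the boundary conditions exactly and the duality relation
   L H^M = Delta H^M up to an error at the bond (M, M+1).  This error is at most a
   constant times eta_M H^{M-1} + eta_{M+1} H^M, and the sum over M telescopes
   because H^M - H^{M+1} >= (1 - q/p) eta_{M+1} H^M if x_1 <= M+1.  Hence the
   average over M <= K of the expectations E[H^M(eta(t), x)] solves the evolution
   equation for u up to O(1/K), uniformly in time and relatively to an exponential
   weight in x.  Delta with its boundary conditions is bounded for the weighted
   norm, so by a Gronwall argument u differs from this average by O(1/K), while the
   average tends to E[H(eta(t), x)] by dominated convergence and Cesaro's lemma. *)

(** * Derivatives relative to the half-line *)

(** For [n >= 1], [H_] is not continuous in the product topology: a configuration with finitely many
    particles is a limit of configurations with infinitely many, at which [H_] vanishes. Neither the
    semigroup nor its generator can be applied to it, hence the local functions [HM]. At a fixed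
    level [M] the duality error is not uniformly small: a single particle at site [M] already makes
    it of order one. Only the sum over [M] is bounded uniformly in the configuration, so the average
    is [O(1/K)] in sup norm. Contractivity of the semigroup carries that bound to every time, with
    no information on the law of the process, such as moments of the number of particles.

    The condition on the rates reads [alpha = p * rho] and [gamma = q * (1 - rho)]: the reservoir
    acts like a virtual site 0 occupied with probability [rho], and [kappa] is the mean of [r ^ b]
    for a Bernoulli variable [b] of mean [rho].

    The growth hypothesis on [u] supplies an exponential weight and an a priori constant; the
    constant is eliminated by the factorials of a Picard iteration. *)

Section RealAnalysis.
Context {R : realType}.
Implicit Types (g f : R -> R) (t l : R).

Lemma has_deriv_ge0P g t l :
  has_deriv_ge0 g t l <->
  (forall e, 0 < e -> exists2 d, 0 < d & forall s, 0 <= s -> s != t ->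
     `|t - s| < d -> `|l - (g s - g t) / (s - t)| <= e).
Proof.
split=> [/cvgrPdist_le H e e0|H].
  have /nbhs_ballP[d /= d0 hd] := H _ e0.
  by exists d => // s s0 st sd; exact: hd.
apply/cvgrPdist_le => e e0; have [d d0 hd] := H _ e0.
by apply/nbhs_ballP; exists d => //= s sd st s0; exact: hd.
Qed.

Lemma has_deriv_ge0D f g t l l' : has_deriv_ge0 f t l -> has_deriv_ge0 g t l' ->
  has_deriv_ge0 (fun s => f s + g s) t (l + l').
Proof.
move=> hf hg; rewrite /has_deriv_ge0.
rewrite (_ : (fun s => _) = (fun s => (f s - f t) / (s - t) + (g s - g t) / (s - t))).
  exact: cvgD.
by apply/funext => s; rewrite -mulrDl; congr (_ / _); ring.
Qed.

Lemma has_deriv_ge0Z a f t l : has_deriv_ge0 f t l ->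
  has_deriv_ge0 (fun s => a * f s) t (a * l).
Proof.
move=> hf; rewrite /has_deriv_ge0.
rewrite (_ : (fun s => _) = (fun s => a * ((f s - f t) / (s - t)))).
  exact: cvgMr.
by apply/funext => s; rewrite -mulrBr mulrA.
Qed.

Lemma has_deriv_ge0_sum n (f : nat -> R -> R) t (l : nat -> R) :
  (forall i, has_deriv_ge0 (f i) t (l i)) ->
  has_deriv_ge0 (fun s => \sum_(i < n) f i s) t (\sum_(i < n) l i).
Proof.
move=> h; elim: n => [|n IH].
  rewrite big_ord0 /has_deriv_ge0.
  rewrite (_ : (fun s => _) = cst 0); first exact: cvg_cst.
  by apply/funext => s; rewrite !big_ord0 subrr mul0r.
rewrite big_ord_recr /= (_ : (fun s => _) = fun s => \sum_(i < n) f i s + f n s).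
  exact: has_deriv_ge0D.
by apply/funext => s; rewrite big_ord_recr.
Qed.

Lemma has_deriv_ge0_cvg g t l : has_deriv_ge0 g t l ->
  g s @[s --> within [set s | 0 <= s] (nbhs t)] --> g t.
Proof.
move=> /has_deriv_ge0P /(_ 1 ltr01)[d d0 hd].
apply/cvgrPdist_le => e e0; apply/nbhs_ballP.
have L0 : 0 < `|l| + 1 by rewrite ltr_wpDl.
exists (Num.min d (e / (`|l| + 1))) => /=; first by rewrite lt_min d0 divr_gt0.
move=> s; rewrite /ball /= lt_min => /andP[sd se] s0.
have [->|st] := eqVneq s t; first by rewrite subrr normr0 ltW.
have := hd s s0 st sd; set r := (g s - g t) / (s - t) => hr.
have -> : g t - g s = r * (t - s).
  by rewrite /r; field; rewrite subr_eq0.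
rewrite normrM; apply: (@le_trans _ _ ((`|l| + 1) * (e / (`|l| + 1)))).
  apply: ler_pM => //; last exact: ltW.
  have -> : r = l - (l - r) by ring.
  by rewrite (le_trans (ler_normB _ _))// lerD2l.
by rewrite mulrC divfK ?gt_eqF.
Qed.

Lemma has_deriv_ge0_is_derive g t l : 0 < t -> has_deriv_ge0 g t l ->
  is_derive t 1 g l.
Proof.
move=> t0 /has_deriv_ge0P H.
suff h : h^-1 *: (g (h *: 1 + t) - g t) @[h --> 0^'] --> l.
  by split; [apply/cvg_ex; exists l | exact/cvg_lim].
apply/cvgrPdist_le => e e0; have [d d0 hd] := H _ e0.
apply/nbhs_ballP; exists (Num.min d t) => /=; first by rewrite lt_min d0.
move=> s; rewrite /ball /= sub0r normrN lt_min => /andP[sd st] s0.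
have := hd (s *: 1 + t); rewrite addrK -[s *: 1]/(s * 1) mulr1 mulrC; apply.
- by move: st; rewrite ltr_norml => /andP[]; lra.
- by rewrite -subr_eq0 addrK.
- by rewrite opprD addrCA subrr addr0 normrN.
Qed.

Lemma is_derive_has_deriv_ge0 g t l : is_derive t 1 g l -> has_deriv_ge0 g t l.
Proof.
move=> [/cvg_ex[l' hl'] hl].
have {hl'} : h^-1 *: (g (h *: 1 + t) - g t) @[h --> 0^'] --> l.
  by rewrite -hl; apply/cvgP; exact: hl'.
move=> /cvgrPdist_le H; apply/has_deriv_ge0P => e e0.
have /nbhs_ballP[d /= d0 hd] := H _ e0.
exists d => // s s0 st sd.
have := hd (s - t); rewrite -[(s - t) *: 1]/((s - t) * 1) mulr1 subrK mulrC; apply.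
  by rewrite /ball /= sub0r opprB.
by rewrite /= subr_eq0.
Qed.

(** At positive times the relative derivative is an ordinary one, so the mean value theorem applies
    inside; at 0 one-sided continuity is enough. *)
Lemma has_deriv_ge0_homo g g' T : 0 <= T ->
  (forall t, 0 <= t <= T -> has_deriv_ge0 g t (g' t)) ->
  (forall t, 0 <= t <= T -> 0 <= g' t) -> g 0 <= g T.
Proof.
rewrite le_eqVlt => /predU1P[<-//|T0] hg g'0.
have hd x : 0 < x <= T -> is_derive x 1 g (g' x).
  move=> /andP[x0 xT].
  by apply: has_deriv_ge0_is_derive => //; apply: hg; rewrite (ltW x0).
have gc x : 0 < x <= T -> {for x, continuous g}.
  by move=> /hd[dg _]; apply: differentiable_continuous; exact/derivable1_diffP.
apply: (@ger0_derive1_le_cc _ g 0 T) => //; rewrite ?in_itv /= ?lexx ?(ltW T0) //.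
- move=> x; rewrite in_itv /= => /andP[x0 xT].
  by have [] : is_derive x 1 g (g' x) by apply: hd; rewrite x0 ltW.
- move=> x; rewrite in_itv /= => /andP[x0 xT]; rewrite derive1E.
  have [_ ->] : is_derive x 1 g (g' x) by apply: hd; rewrite x0 ltW.
  by apply: g'0; rewrite !ltW.
apply/continuous_within_itvP => //; split.
- by move=> x; rewrite in_itv /= => /andP[x0 xT]; apply: gc; rewrite x0 ltW.
- have /hg/has_deriv_ge0_cvg h : 0 <= (0 : R) <= T by apply/andP; split => //; exact: ltW.
  move/cvgrPdist_le : h => h; apply/cvgrPdist_le => e /h.
  move=> /nbhs_ballP[d /= d0 hb]; apply/nbhs_ballP; exists d => // s sd s0.
  exact: hb sd (ltW s0).
- by apply: cvg_within_filter; apply: gc; rewrite T0 lexx.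
Qed.

(* |g| <= f by comparing the derivatives of f - g and f + g *)
Lemma has_deriv_ge0_le g g' f f' T :
  (forall t, 0 <= t <= T -> has_deriv_ge0 g t (g' t)) ->
  (forall t, 0 <= t <= T -> has_deriv_ge0 f t (f' t)) ->
  (forall t, 0 <= t <= T -> `|g' t| <= f' t) -> `|g 0| <= f 0 ->
  forall t, 0 <= t <= T -> `|g t| <= f t.
Proof.
move=> hg hf hgf h0 t /andP[t0 tT].
have sub s : 0 <= s <= t -> 0 <= s <= T.
  by move=> /andP[-> /le_trans]; exact.
have := @has_deriv_ge0_homo (fun s => f s + g s) (fun s => f' s + g' s) t t0.
have := @has_deriv_ge0_homo (fun s => f s + -1 * g s) (fun s => f' s + -1 * g' s) t t0.
move: h0; rewrite !ler_norml => /andP[g1 g2] H1 H2.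
have {}H1 : f 0 + -1 * g 0 <= f t + -1 * g t.
  apply: H1 => s /sub sT.
    by apply: has_deriv_ge0D; [exact: hf | apply: has_deriv_ge0Z; exact: hg].
  by have := hgf s sT; rewrite ler_norml => /andP[]; lra.
have {}H2 : f 0 + g 0 <= f t + g t.
  apply: H2 => s /sub sT; first by apply: has_deriv_ge0D; [exact: hf | exact: hg].
  by have := hgf s sT; rewrite ler_norml => /andP[]; lra.
by apply/andP; split; lra.
Qed.

End RealAnalysis.

(** * Gronwall's inequality by Picard iteration in a weighted sup norm *)

Section Picard.
Context {R : realType}.

(** [exp_coeff (L * t) m] is [(L t)^m / m!], what is left of the a priori bound [B] after [m]
    iterations. The rate [L + 1] instead of [L] absorbs the source term [eps]. *)
Let majorant (eps L B : R) (m : nat) (t : R) : R := eps * expR ((L + 1) * t) + B * exp_coeff (L * t) m.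

Let is_derive_majorant (eps L B : R) m (t : R) :
  is_derive t (1 : R) (majorant eps L B m.+1)
    (eps * ((L + 1) * expR ((L + 1) * t)) + B * (L * exp_coeff (L * t) m)).
Proof.
pose c : R := B * L ^+ m.+1 / (m.+1)`!%:R.
have -> : majorant eps L B m.+1 =
    (fun s => eps * expR ((L + 1) * s)) + (fun s => c * s ^+ m.+1).
  apply/funext => s; rewrite /majorant /exp_coeff /c /= exprMn.
  by congr (_ + _); rewrite !mulrA; ring.
apply: is_deriveD.
  have h : is_derive t (1 : R) (fun s : R => (L + 1) * s) (L + 1).
    have := is_deriveZ (L + 1) (is_derive_id t (1 : R)).
    by rewrite /GRing.scale /= mulr1.
  have := is_deriveZ eps (is_derive1_comp (is_derive_expR ((L + 1) * t)) h).
  by rewrite /GRing.scale /= [_ * (L + 1)]mulrC.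
have := is_deriveZ c (is_deriveX m.+1 (is_derive_id t (1 : R))).
rewrite exprfctE /GRing.scale /= mulr1 => h.
suff <- : c * (m.+1%:R * t ^+ m) = B * (L * exp_coeff (L * t) m) by exact: h.
rewrite /c /exp_coeff /= factS natrM exprMn exprS.
by field; rewrite nat1r !pnatr_eq0 -lt0n fact_gt0.
Qed.

(* The iteration of the integral inequality |w t| <= eps + int_0^t (L |w s| + eps) ds,
   started from the a priori bound B. *)
Lemma weighted_gronwall (I : Type) (D : set I) (W : I -> R) (w w' : R -> I -> R)
    (T L eps B : R) : 0 <= L -> 0 <= eps -> (forall x, D x -> 0 <= W x) ->
  (forall t x, 0 <= t <= T -> D x -> has_deriv_ge0 (w ^~ x) t (w' t x)) ->
  (forall t b, 0 <= t <= T -> (forall x, D x -> `|w t x| <= b * W x) ->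
     forall x, D x -> `|w' t x| <= (L * b + eps) * W x) ->
  (forall x, D x -> `|w 0 x| <= eps * W x) ->
  (forall t x, 0 <= t <= T -> D x -> `|w t x| <= B * W x) ->
  forall t x, 0 <= t <= T -> D x -> `|w t x| <= eps * expR ((L + 1) * t) * W x.
Proof.
move=> L0 eps0 W0 hw hb h0 hB.
have H m : forall t x, 0 <= t <= T -> D x -> `|w t x| <= majorant eps L B m t * W x.
  elim: m => [|m IH] t x tT Dx.
    apply: (le_trans (hB t x tT Dx)); apply: ler_wpM2r; first exact: W0.
    rewrite /majorant /exp_coeff /= expr0 fact0 divr1 mulr1 lerDr.
    by rewrite mulr_ge0 ?expR_ge0.
  rewrite mulrC; apply: (@has_deriv_ge0_le _ (w ^~ x) (w' ^~ x)
    (fun t => W x * majorant eps L B m.+1 t) (fun t => W x *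
    (eps * ((L + 1) * expR ((L + 1) * t)) + B * (L * exp_coeff (L * t) m))) T) => //.
  - by move=> s sT; exact: hw.
  - by move=> s sT; apply/has_deriv_ge0Z/is_derive_has_deriv_ge0.
  - move=> s sT; have := hb s _ sT (fun x => IH s x sT) x Dx.
    move=> /le_trans; apply; rewrite mulrC; apply: ler_wpM2l; first exact: W0.
    rewrite /majorant; set e := expR _; set k := exp_coeff _ _.
    have e1 : 1 <= e.
      by rewrite -expR0 ler_expR mulr_ge0 ?addr_ge0//; case/andP: sT.
    (* The derivative of the next majorant exceeds [L] times the current one plus [eps] by exactly
       this surplus. *)
    rewrite -subr_ge0 (_ : _ - _ = eps * (e - 1)); last ring.
    by rewrite mulr_ge0// subr_ge0.
  - rewrite /majorant !mulr0 expR0 mulr1 {1}/exp_coeff /= expr0n mul0r mulr0 addr0 mulrC.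
    exact: h0.
move=> t x tT Dx.
have cv : majorant eps L B m t * W x @[m --> \oo] --> eps * expR ((L + 1) * t) * W x.
  apply: cvgMl; rewrite -[X in _ --> X]addr0; apply: cvgD; first exact: cvg_cst.
  by rewrite -(mulr0 B); apply: cvgMr; exact: cvg_exp_coeff.
rewrite -(cvg_lim _ cv)//; apply: limr_ge; first by apply/cvg_ex; eexists; exact: cv.
by apply: nearW => m; exact: H.
Qed.

End Picard.

(** * The operator Delta on the Weyl chamber *)

Section Lattice.
Context {R : realType}.

Lemma updE n (x : {ffun 'I_n -> nat}) i k j : upd x i k j = if j == i then k else x j.
Proof. by rewrite ffunE. Qed.

Lemma weyl_inj n (x : {ffun 'I_n -> nat}) : weyl x -> injective x.
Proof.
move=> [_ xlt] i j xij; apply/val_inj/eqP; rewrite eqn_leq; apply/andP; split;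
  by rewrite leqNgt; apply/negP => /xlt; rewrite xij ltnn.
Qed.

Lemma weyl_shift_p n (x : {ffun 'I_n -> nat}) (i : 'I_n) : weyl x ->
  (forall j : 'I_n, j = i.+1 :> nat -> x j != (x i).+1) -> weyl (shift_p x i).
Proof.
move=> wx hi; have [x1 xlt] := wx; split=> [j|j k jk]; rewrite /shift_p !updE.
  by case: ifP.
case: (eqVneq j i) => [ji|ji]; case: (eqVneq k i) => [ki|ki] //.
- by move: jk; rewrite ji ki ltnn.
- rewrite ji in jk; have ij := leq_ltn_trans jk (ltn_ord k).
  have := hi (Ordinal ij) erefl; have /= := xlt i (Ordinal ij) (ltnSn _).
  move: jk; rewrite leq_eqVlt => /orP[/eqP jk|jk].
    have -> : Ordinal ij = k by exact/val_inj.
    by move=> ? ?; rewrite ltn_neqAle eq_sym; apply/andP.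
  have := xlt (Ordinal ij) k jk; lia.
- by rewrite ki in jk; apply: ltnW; rewrite ltnS; exact: xlt.
- exact: xlt.
Qed.

Lemma weyl_shift_m n (x : {ffun 'I_n -> nat}) (i : 'I_n) : weyl x ->
  (1 < x i)%N -> (forall j : 'I_n, i = j.+1 :> nat -> x i != (x j).+1) ->
  weyl (shift_m x i).
Proof.
move=> wx xi hi; have [x1 xlt] := wx; split=> [j|j k jk]; rewrite /shift_m !updE.
  by case: ifP => // _; lia.
case: (eqVneq j i) => [ji|ji]; case: (eqVneq k i) => [ki|ki] //.
- by move: jk; rewrite ji ki ltnn.
- by rewrite ji in jk; have := xlt i k jk; lia.
- rewrite ki in jk.
  have [i' ii] : exists i' : 'I_n, i = i'.+1 :> nat.
    by have i0 : (i.-1 < n)%N by [have := ltn_ord i; lia]; exists (Ordinal i0) => /=; lia.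
  have := hi i' ii; have := xlt i' i; rewrite {1}ii ltnSn => /(_ isT).
  have [->|ji'] := eqVneq j i'; first by lia.
  have : (j < i')%N by rewrite ltn_neqAle -ltnS -ii jk andbT.
  by move=> /xlt; lia.
- exact: xlt.
Qed.

(* On the boundary of the Weyl chamber the ill-defined neighbours of a point in
   Delta cancel pairwise (first condition) or are reduced to the point itself
   (second condition), so Delta acts on functions on the chamber. *)
Definition boundary_cond (p q kappa : R) n (f : {ffun 'I_n -> nat} -> R) : Prop :=
  (forall (i j : 'I_n) x, weyl x -> j = i.+1 :> nat -> x j = (x i).+1 ->
     p * f (shift_m x j) + q * f (shift_p x i) = (p + q) * f x) /\
  (forall (i : 'I_n) x, weyl x -> i = 0%N :> nat -> x i = 1%N ->
     f (upd x i 0) = kappa * f x).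

(** Each down-move is paired with the up-move of the coordinate to its left. For [n >= 1] the
    [n - 1] pairs, the down-move of the first coordinate and the up-move of the last make [n + 1]
    pieces, each at most [(p + q) (E + 1) b W x]. *)
Lemma Delta_le (p q kappa E b : R) n (W f : {ffun 'I_n -> nat} -> R) :
  0 <= p -> 0 <= q -> 0 <= kappa <= 1 -> 1 <= E ->
  (forall x, 0 <= W x) -> (forall x i, W (shift_p x i) <= E * W x) ->
  (forall x i, W (shift_m x i) <= E * W x) ->
  boundary_cond p q kappa f -> (forall x, weyl x -> `|f x| <= b * W x) ->
  forall x, weyl x ->
  `|Delta p q f x| <= n.+1%:R * ((p + q) * (E + 1)) * b * W x.
Proof.
case: n W f => [|n] W f p0 q0 /andP[k0 k1] E1 W0 Wp Wm [hcl hbd] hb x wx;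
  have bW0 : 0 <= b * W x by rewrite (le_trans _ (hb x wx)).
  by rewrite /Delta big_ord0 normr0 -mulrA mulr_ge0// mulr_ge0// mulr_ge0 ?addr_ge0// (le_trans ler01).
have E0 : 0 <= E by rewrite (le_trans ler01).
set a := fun i => p * (f (shift_m x i) - f x).
set c := fun i => q * (f (shift_p x i) - f x).
have DE : Delta p q f x = \sum_i a i + \sum_i c i.
  by rewrite -big_split; apply: eq_bigr => i _; rewrite /a /c /=; ring.
have bd0 (k g : R) : 0 <= k -> `|g| <= E * (b * W x) ->
    `|k * (g - f x)| <= k * (E + 1) * (b * W x).
  move=> k0' hg; rewrite normrM (ger0_norm k0') -mulrA; apply: ler_wpM2l => //.
  apply: (le_trans (ler_normB _ _)); rewrite mulrDl mul1r; apply: lerD => //.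
  exact: hb.
have bdW y : weyl y -> W y <= E * W x -> `|f y| <= E * (b * W x).
  move=> wy hy; have hfy := hb y wy; have Wy := W0 y.
  (* The sign of [b] is not given; if [b <= 0], the bound at [y] forces [f y = 0]. *)
  have [b0|b0] := orP (le_total 0 b).
    by rewrite (le_trans hfy)// mulrCA; exact: ler_wpM2l.
  suff : b * W y <= 0 by move=> /(le_trans hfy); move=> /le_trans; apply; rewrite mulr_ge0.
  by rewrite mulr_le0_ge0.
have bda (i : 'I_n.+1) : (forall j : 'I_n.+1, i = j.+1 :> nat -> x i != (x j).+1) ->
    `|a i| <= p * (E + 1) * (b * W x).
  move=> hi; apply: bd0 => //.
  have [xi|xi] := ltnP 1 (x i); first exact/bdW/Wm/weyl_shift_m.
  have xi1 : x i = 1%N by have [/(_ i)] := wx; lia.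
  have i0 : i = 0%N :> nat.
    apply/eqP; rewrite -leqn0 leqNgt; apply/negP => i0.
    have := (wx.2 (Ordinal (ltn_trans i0 (ltn_ord i))) i i0).
    by have := (wx.1 (Ordinal (ltn_trans i0 (ltn_ord i)))); rewrite xi1; lia.
  rewrite /shift_m xi1 hbd// normrM ger0_norm//.
  apply: ler_pM => //; [exact: le_trans E1 | exact: hb].
have bdc (i : 'I_n.+1) : (forall j : 'I_n.+1, j = i.+1 :> nat -> x j != (x i).+1) ->
    `|c i| <= q * (E + 1) * (b * W x).
  by move=> hi; apply: bd0 => //; exact/bdW/Wp/weyl_shift_p.
have {DE} -> : `|Delta p q f x| = `|\sum_i a i + \sum_i c i| by rewrite DE.
set B := (p + q) * (E + 1) * (b * W x).
have pB : p * (E + 1) * (b * W x) <= B.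
  by rewrite /B ler_wpM2r// ler_wpM2r ?addr_ge0// lerDl.
have qB : q * (E + 1) * (b * W x) <= B.
  by rewrite /B ler_wpM2r// ler_wpM2r ?addr_ge0// lerDr.
have -> : n.+2%:R * ((p + q) * (E + 1)) * b * W x = n.+2%:R * B by rewrite /B; ring.
have B0 : 0 <= B by apply: le_trans pB; rewrite mulr_ge0 ?bW0 ?mulr_ge0 ?addr_ge0.
(* One sum is opened at its first index and the other at its last, so that the remaining terms align
   the two moves that may collide. *)
rewrite big_ord_recl [X in _ + X]big_ord_recr /=.
have -> : forall u v w z : R, u + v + (w + z) = u + z + (v + w) by move=> *; ring.
rewrite -big_split /= (_ : n.+2%:R * B = B + B + \sum_(i < n) B); last first.
  by rewrite sumr_const card_ord -[X in X * _]natr1 -natr1 -mulr_natl; ring.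
apply: (le_trans (ler_normD _ _)); apply: lerD.
  apply: (le_trans (ler_normD _ _)); apply: lerD.
    by apply: (le_trans (bda _ _)) => // j /=.
  apply: (le_trans (bdc _ _)) => // j /= jn.
  by have := ltn_ord j; rewrite jn ltnn.
apply: (le_trans (ler_norm_sum _ _ _)); apply: ler_sum => i _.
set j := lift ord0 i; set i' := widen_ord _ i.
have ji : j = i'.+1 :> nat by [].
(* For adjacent coordinates both moves leave the chamber and cancel exactly; otherwise each is
   bounded separately. *)
have [xj|xj] := eqVneq (x j) (x i').+1.
  suff -> : a j + c i' = 0 by rewrite normr0.
  have := hcl i' j x wx ji xj; rewrite /a /c => h.
  transitivity (p * f (shift_m x j) + q * f (shift_p x i') - (p + q) * f x); first by ring.
  by rewrite h subrr.
apply: (le_trans (ler_normD _ _)); rewrite /B mulrDl mulrDl; apply: lerD.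
  by apply: bda => k; rewrite ji => -[ik]; have -> : k = i' by exact: ord_inj.
by apply: bdc => k; rewrite -ji => kj; have -> : k = j by exact: ord_inj.
Qed.
End Lattice.

(** * Approximate duality for truncated observables *)

Section TruncatedDuality.
Context {R : realType}.
Implicit Types (eta xi : config) (M y z : nat).

Definition cnt M y eta : nat := \sum_(y <= k < M.+1) occ eta k.

Lemma cnt_gt M y eta : (M < y)%N -> cnt M y eta = 0%N.
Proof. by move=> My; rewrite /cnt big_geq. Qed.

Lemma cntS M y eta : (y <= M)%N -> cnt M y eta = (occ eta y + cnt M y.+1 eta)%N.
Proof. by move=> yM; rewrite /cnt big_ltn. Qed.

Lemma cntMS M y eta : (y <= M.+1)%N -> cnt M.+1 y eta = (cnt M y eta + occ eta M.+1)%N.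
Proof. by move=> yM; rewrite /cnt big_nat_recr. Qed.

Lemma cnt_leM M y eta : (cnt M y eta <= cnt M.+1 y eta)%N.
Proof.
have [yM|yM] := leqP y M.+1; first by rewrite cntMS// leq_addr.
by rewrite !cnt_gt// ltnW.
Qed.

Lemma eq_cnt M y eta xi : (forall k, (y <= k <= M)%N -> occ eta k = occ xi k) ->
  cnt M y eta = cnt M y xi.
Proof. by move=> h; apply: eq_big_nat => k kM; rewrite h. Qed.

Lemma occ_exchange eta x y k : (0 < x)%N -> (0 < y)%N -> (0 < k)%N ->
  occ (exchange eta x y) k =
  if k == x then occ eta y else if k == y then occ eta x else occ eta k.
Proof. by case: k => // k _ _ _; rewrite {1}/occ /exchange. Qed.

Lemma occ_flip eta x k : (0 < k)%N ->
  occ (flip eta x) k = if k == x then ~~ occ eta k else occ eta k.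
Proof. by case: k => // k _; rewrite {1}/occ /flip. Qed.

(** The window from [z] to [M] contains both ends of the bond or neither, unless it starts or stops
    between them. *)
Lemma cnt_exchange M y z eta : (0 < y)%N -> (0 < z)%N -> y != M -> z != y.+1 ->
  cnt M z (exchange eta y y.+1) = cnt M z eta.
Proof.
move=> y0 z0 yM zy.
have [My|My] := ltnP M y.
  by apply: eq_cnt => k kM; rewrite occ_exchange//; [do 2 (case: eqP; first by lia) | lia].
have {}My : (y < M)%N by rewrite ltn_neqAle yM.
have [yz|yz] := ltnP y z.
  by apply: eq_cnt => k kM; rewrite occ_exchange//; [do 2 (case: eqP; first by lia) | lia].
have yM1 : (y <= M.+1)%N by lia.
rewrite /cnt !(big_cat_nat yz yM1) /=.
congr (_ + _)%N.
  apply: eq_big_nat => k kM; rewrite occ_exchange//; last by lia.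
  by do 2 (case: eqP; first by lia).
rewrite !(@big_ltn _ _ _ y); [|lia..]; rewrite !(@big_ltn _ _ _ y.+1); [|lia..].
rewrite !addnA !occ_exchange// !eqxx (_ : y.+1 == y = false); last by apply/eqP; lia.
congr (_ + _)%N; first exact: addnC.
apply: eq_big_nat => k kM; rewrite occ_exchange//; last by lia.
by do 2 (case: eqP; first by lia).
Qed.

Lemma cnt_exchangeS M y eta : (0 < y)%N -> (y < M)%N ->
  cnt M y.+1 (exchange eta y y.+1) = (occ eta y + cnt M y.+2 eta)%N.
Proof.
move=> y0 yM; rewrite cntS// cnt_exchange//; [|lia..].
by rewrite occ_exchange// eqxx (_ : y.+1 == y = false)//; apply/eqP; lia.
Qed.

Lemma cnt_flip M z eta : (1 < z)%N -> cnt M z (flip eta 1) = cnt M z eta.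
Proof.
by move=> z1; apply: eq_cnt => k kM; rewrite occ_flip; [case: eqP => //; lia | lia].
Qed.

Definition bond (p q : R) (f : config -> R) eta y : R :=
  p * ((occ eta y)%:R * (1 - (occ eta y.+1)%:R)) * (f (exchange eta y y.+1) - f eta)
  + q * ((occ eta y.+1)%:R * (1 - (occ eta y)%:R)) * (f (exchange eta y y.+1) - f eta).

(** The bond from [m] to [m.+1] is the last one to touch a site that [f] sees. *)
Lemma asep_gen_finite (p q alpha gamma : R) m (f : config -> R) eta :
  (forall eta xi, (forall x, (1 <= x <= m)%N -> occ eta x = occ xi x) -> f eta = f xi) ->
  asep_gen p q alpha gamma f eta = \sum_(1 <= y < m.+1) bond p q f eta y
    + alpha * (1 - (occ eta 1)%:R) * (f (flip eta 1) - f eta)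
    + gamma * (occ eta 1)%:R * (f (flip eta 1) - f eta).
Proof.
move=> hm; congr (_ + _ + _); apply: cvg_lim => //; apply: cvg_near_cst.
exists m.+1 => // N /= mN; rewrite (@big_cat_nat _ _ _ m.+1)//=.
rewrite [X in _ + X]big1_seq ?addr0// => y; rewrite mem_index_iota => /and3P[_ my _].
rewrite (hm (exchange _ _ _) eta) ?subrr ?mulr0 ?addr0// => x xm.
rewrite occ_exchange//; [|lia..].
by do 2 (case: eqP; first by lia).
Qed.

Variables (p q alpha gamma rho : R).
Let r := q / p.
Let kappa := rho * r + 1 - rho.

(* Only the sites up to M are counted; the value at y = 0 is forced by the
   reservoir boundary condition. *)
Definition QM M eta y : R :=
  if y is 0 then kappa * r ^+ cnt M 1 eta else r ^+ cnt M y eta.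

Definition HM M n eta (x : {ffun 'I_n -> nat}) : R := \prod_(i < n) QM M eta (x i).

Lemma eq_HM M n eta xi (x : {ffun 'I_n -> nat}) :
  (forall k, (1 <= k <= M)%N -> occ eta k = occ xi k) -> HM M eta x = HM M xi x.
Proof.
move=> h; apply: eq_bigr => i _; rewrite /QM.
case: (x i) => [|y]; first by congr (_ * r ^+ _); exact: eq_cnt.
by congr (r ^+ _); apply: eq_cnt => k /andP[yk kM]; apply: h; lia.
Qed.

Lemma local_HM M n (x : {ffun 'I_n -> nat}) : local_fun (fun zeta => HM M zeta x).
Proof. by exists M => eta xi; exact: eq_HM. Qed.

Hypothesis (q0 : 0 < q) (qp : q < p).
Hypothesis (hL : alpha / p + gamma / q = 1) (hrho : rho = alpha / p).

Let p0 : 0 < p. Proof. exact: lt_trans qp. Qed.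
Let r0 : 0 < r. Proof. exact: divr_gt0. Qed.
Let r1 : r < 1. Proof. by rewrite /r ltr_pdivrMr// mul1r. Qed.
Let pr : p * r = q. Proof. by rewrite /r mulrC divfK// gt_eqF. Qed.
Let prho : p * rho = alpha. Proof. by rewrite hrho mulrC divfK// gt_eqF. Qed.
Let gammaE : gamma = (p - alpha) * r.
Proof.
have -> : gamma = q * (gamma / q) by rewrite mulrC divfK// gt_eqF.
rewrite (_ : gamma / q = 1 - alpha / p); last by rewrite -hL addrC addKr.
by rewrite -pr; field; rewrite gt_eqF.
Qed.

Lemma QM_pos M eta y : (0 < y)%N -> QM M eta y = r ^+ cnt M y eta.
Proof. by case: y. Qed.

Lemma QM_ge0 M eta y : (0 < y)%N -> 0 <= QM M eta y.
Proof. by move=> y0; rewrite QM_pos// exprn_ge0// ltW. Qed.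

Lemma QM_le1 M eta y : (0 < y)%N -> QM M eta y <= 1.
Proof. by move=> y0; rewrite QM_pos// exprn_ile1// ltW. Qed.

Lemma QM_leM M eta y : (0 < y)%N -> QM M.+1 eta y <= QM M eta y.
Proof. by move=> y0; rewrite !QM_pos//; apply: ler_wiXn2l; rewrite ?ltW// cnt_leM. Qed.

Lemma HM_ge0 M n eta (x : {ffun 'I_n -> nat}) : weyl x -> 0 <= HM M eta x.
Proof. by move=> [x1 _]; apply: prodr_ge0 => i _; exact: QM_ge0. Qed.

Lemma HM_leM M n eta (x : {ffun 'I_n -> nat}) : weyl x -> HM M.+1 eta x <= HM M eta x.
Proof.
by move=> [x1 _]; apply: ler_prod => i _; rewrite QM_ge0// QM_leM.
Qed.

Lemma HM_le1 M n eta (x : {ffun 'I_n -> nat}) : weyl x -> HM M eta x <= 1.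
Proof.
by move=> [x1 _]; apply: prodr_ile1 => i _; rewrite QM_ge0// QM_le1.
Qed.

Let HM_D1 M n eta (x : {ffun 'I_n -> nat}) i :
  HM M eta x = QM M eta (x i) * \prod_(j < n | j != i) QM M eta (x j).
Proof. by rewrite /HM (bigD1 i). Qed.

Lemma HM_upd M n eta (x : {ffun 'I_n -> nat}) i k (c : R) :
  QM M eta k = c * QM M eta (x i) -> HM M eta (upd x i k) = c * HM M eta x.
Proof.
move=> h; rewrite !(HM_D1 _ _ _ i) updE eqxx h mulrA.
by congr (_ * _); apply: eq_bigr => j /negPf ji; rewrite updE ji.
Qed.

(** Sites beyond [M] count as empty, so the shift identities below hold at every position without a
    case distinction on [M]. *)
Let tau M eta y : bool := (y <= M)%N && occ eta y.

Let QM_S M eta y : (0 < y)%N -> QM M eta y = r ^+ tau M eta y * QM M eta y.+1.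
Proof.
move=> y0; rewrite !QM_pos// -exprD /tau; have [yM|yM] := leqP y M.
  by rewrite cntS.
by rewrite !cnt_gt// ltnW.
Qed.

(** Dropping an occupied site from the window divides the factor by [r], and [q / r = p]. In
    [p_shift_m], adding one multiplies it by [r], and [p * r = q]. *)
Let q_shift_p M n eta (x : {ffun 'I_n -> nat}) i : (0 < x i)%N ->
  q * HM M eta (shift_p x i) = (q + (p - q) * (tau M eta (x i))%:R) * HM M eta x.
Proof.
move=> x0; rewrite -[in LHS]pr; have := @QM_S M eta (x i) x0.
case: tau => /= h.
  have {h}/HM_upd : QM M eta (x i).+1 = r^-1 * QM M eta (x i).
    by rewrite h expr1 mulKf// gt_eqF.
  by rewrite /shift_p => ->; field; rewrite gt_eqF.
have {h}/HM_upd : QM M eta (x i).+1 = 1 * QM M eta (x i) by rewrite h expr0 !mul1r.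
by rewrite /shift_p => ->; rewrite pr; ring.
Qed.

Let p_shift_m M n eta (x : {ffun 'I_n -> nat}) i : (1 < x i)%N ->
  p * HM M eta (shift_m x i) = (p - (p - q) * (tau M eta (x i).-1)%:R) * HM M eta x.
Proof.
move=> x1; have := @QM_S M eta (x i).-1; rewrite prednK; last by lia.
move=> h; rewrite /shift_m (HM_upd (h _)); last by lia.
by case: tau => /=; rewrite mulrA ?expr1 ?pr; ring.
Qed.

(** For adjacent coordinates the two shifts involve the same occupation variable with opposite
    signs, so the coefficients add up to [p + q]. *)
Lemma HM_boundary M n eta : boundary_cond p q kappa (HM M eta : {ffun 'I_n -> nat} -> R).
Proof.
split=> [i j x [x1 _] ji xji|i x wx i0 xi]; last by apply: HM_upd; rewrite xi.
by rewrite q_shift_p// p_shift_m ?xji//= ?ltnS//; ring.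
Qed.

(** The contribution to [Delta] of a coordinate at [y], relative to [HM]. The constant at [y = 1] is
    [p * (kappa - 1)], which equals [alpha * (r - 1)]. *)
Let g M eta y : R :=
  if y == 1%N then alpha * (r - 1) + (p - q) * (tau M eta 1)%:R
  else (p - q) * ((tau M eta y)%:R - (tau M eta y.-1)%:R).

Let Delta_HM M n eta (x : {ffun 'I_n -> nat}) : weyl x ->
  Delta p q (HM M eta) x = \sum_(i < n) g M eta (x i) * HM M eta x.
Proof.
move=> [x1 xlt]; apply: eq_bigr => i _; rewrite q_shift_p// /g.
have [xi|xi] := eqVneq (x i) 1%N; last by rewrite p_shift_m; [ring | have := x1 i; lia].
rewrite xi /shift_m xi (@HM_upd _ _ _ _ _ _ kappa) ?xi// /kappa.
have -> : alpha = p * rho by rewrite prho.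
by ring.
Qed.

(* A local change of the configuration affects at most one factor of HM, as the
   coordinates of x are distinct. *)
Let HM_change M n eta xi (x : {ffun 'I_n -> nat}) z (a c : R) : weyl x ->
  (forall y, (0 < y)%N -> y != z -> QM M xi y = QM M eta y) ->
  a * (QM M xi z - QM M eta z) = c * QM M eta z ->
  a * (HM M xi x - HM M eta x) = \sum_(i < n) (if x i == z then c else 0) * HM M eta x.
Proof.
move=> wx hy hz; have [x1 _] := wx.
have [/existsP[i /eqP xi_z]|/existsPn none] := boolP [exists i, x i == z].
  rewrite [RHS](bigD1 i)//= xi_z eqxx [X in _ = _ + X]big1 ?addr0; last first.
    move=> j /eqP ji; case: eqP => [xj|_]; last by rewrite mul0r.
    by case: ji; apply: (weyl_inj wx); rewrite xj.
  have hprod : \prod_(j < n | j != i) QM M xi (x j) = \prod_(j < n | j != i) QM M eta (x j).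
    apply: eq_bigr => j /eqP ji; apply: hy => //; apply/eqP => xj.
    by case: ji; apply: (weyl_inj wx); rewrite xj.
  by rewrite !(HM_D1 _ _ _ i) xi_z hprod -mulrBl [LHS]mulrA hz mulrA.
rewrite big1 => [|i _]; last by rewrite (negPf (none i)) mul0r.
rewrite (_ : HM M xi x = HM M eta x) ?subrr ?mulr0//.
by apply: eq_bigr => j _; apply: hy.
Qed.

(** Only the factor at [y.+1] changes: by [r] at rate [p], or by [1 / r] at rate [q]. As
    [p (r - 1) = q - p] and [q (1 / r - 1) = p - q], one linear expression covers the four local
    states. *)
Let bond_lt M n eta (x : {ffun 'I_n -> nat}) y : weyl x -> (0 < y)%N -> (y < M)%N ->
  bond p q (fun zeta => HM M zeta x) eta y = \sum_(i < n) (if x i == y.+1 then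
    (p - q) * ((occ eta y.+1)%:R - (occ eta y)%:R) else 0) * HM M eta x.
Proof.
move=> wx y0 yM; rewrite /bond -mulrDl; apply: HM_change => //.
  by move=> z z0 zy; rewrite !QM_pos// cnt_exchange//; lia.
rewrite !QM_pos// cnt_exchangeS// (cntS _ yM) !exprD.
by rewrite -pr; case: (occ eta y); case: (occ eta y.+1) => /=; rewrite ?expr1 ?expr0; ring.
Qed.

(** The condition on the rates enters here: at an occupied site 1,
    [gamma (1 / r - 1) = (p - alpha) (1 - r)], which is [alpha (r - 1) + (p - q)], the value of [g]
    there. *)
Let flip_HM M n eta (x : {ffun 'I_n -> nat}) : weyl x -> (0 < M)%N ->
  alpha * (1 - (occ eta 1)%:R) * (HM M (flip eta 1) x - HM M eta x)
  + gamma * (occ eta 1)%:R * (HM M (flip eta 1) x - HM M eta x)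
  = \sum_(i < n) (if x i == 1%N then alpha * (r - 1) + (p - q) * (occ eta 1)%:R else 0)
       * HM M eta x.
Proof.
move=> wx M0; rewrite -mulrDl; apply: HM_change => //.
  by move=> z z0 zy; rewrite !QM_pos// cnt_flip//; lia.
rewrite !QM_pos// !(cntS _ M0) cnt_flip// !exprD occ_flip//= gammaE -pr.
by case: (occ eta 1) => /=; rewrite ?expr1 ?expr0; ring.
Qed.

Definition dual_error M n eta (x : {ffun 'I_n -> nat}) : R :=
  asep_gen p q alpha gamma (fun zeta => HM M zeta x) eta - Delta p q (HM M eta) x.

(** A coordinate at 1 is matched by the reservoir, one at [y] with [2 <= y <= M] by the bond from
    [y - 1] to [y], and beyond [M + 1] both sides vanish. What remains is the bond at [M] and the
    unmatched part of [g] at [M + 1]. *)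
Let dual_errorE M n eta (x : {ffun 'I_n -> nat}) : weyl x -> (0 < M)%N ->
  dual_error M eta x = bond p q (fun zeta => HM M zeta x) eta M +
    \sum_(i < n) (if x i == M.+1 then (p - q) * (occ eta M)%:R else 0) * HM M eta x.
Proof.
move=> wx M0; rewrite /dual_error (@asep_gen_finite _ _ _ _ M); last first.
  by move=> ? ? ?; exact: eq_HM.
rewrite -[X in X - _]addrA flip_HM// Delta_HM//.
rewrite big_nat_recr//=.
under eq_big_nat => y /andP[y0 yM] do rewrite bond_lt//.
have key (a b c e h : R) : a + c - e = h -> a + b + c - e = b + h by move=> <-; ring.
apply: key; rewrite exchange_big -big_split -sumrB; apply: eq_bigr => i _ /=.
rewrite -mulr_suml -!mulrDl -mulrBl; congr (_ * _).
have x1 := wx.1 i.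
rewrite /g /tau.
have [xi|xi] := eqVneq (x i) 1%N.
  rewrite big1_seq => [|y]; last by rewrite mem_index_iota; case: eqP => //; lia.
  rewrite xi M0; have -> : (1 == M.+1)%N = false by apply/eqP; lia.
  by rewrite /=; ring.
have [iM|iM] := leqP (x i) M.
  have xM : (x i == M.+1) = false by apply/eqP; lia.
  rewrite (bigD1_seq (x i).-1) ?iota_uniq ?mem_index_iota /=; [|lia..].
  rewrite prednK// eqxx big1 => [|y /eqP yx]; last by case: eqP => // xy; case: yx; rewrite xy.
  have -> : ((x i).-1 <= M)%N by lia.
  by rewrite xM /=; ring.
rewrite big1_seq => [|y]; last by rewrite mem_index_iota; case: eqP => //; lia.
have [xM|xM] := eqVneq (x i) M.+1; first by rewrite xM /= leqnn /=; ring.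
have -> : ((x i).-1 <= M)%N = false by lia.
by rewrite /=; ring.
Qed.

Lemma dual_error_le M n eta (x : {ffun 'I_n -> nat}) : weyl x ->
  `|dual_error M.+1 eta x| <= n.+1%:R * p *
    ((occ eta M.+1)%:R * HM M eta x + (occ eta M.+2)%:R * HM M.+1 eta x).
Proof.
move=> wx; rewrite dual_errorE//; set e := exchange eta M.+1 M.+2.
(* The truncation one site earlier does not see the exchanged sites, so it dominates [HM M.+1] both
   before and after the exchange. *)
have eM : HM M e x = HM M eta x.
  apply: eq_bigr => i _; rewrite !QM_pos ?wx.1//; congr (r ^+ _); apply: eq_cnt => k kM.
  have := wx.1 i => xi.
  by rewrite occ_exchange//; [do 2 (case: eqP; first by lia) | lia].
have h0 : HM M.+1 eta x <= HM M eta x := HM_leM _ _ wx.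
have h1 : HM M.+1 e x <= HM M eta x by rewrite -eM; exact: HM_leM.
have h2 : 0 <= HM M.+1 eta x := HM_ge0 _ _ wx.
have h3 : 0 <= HM M.+1 e x := HM_ge0 _ _ wx.
have dist : `|HM M.+1 e x - HM M.+1 eta x| <= HM M eta x.
  by rewrite ler_norml; apply/andP; split; lra.
(* With site [M.+1] empty the two truncations agree; this gives the factor [HM M.+1] that goes with
   a particle at [M.+2]. *)
have dist' : ~~ occ eta M.+1 -> `|HM M.+1 e x - HM M.+1 eta x| <= HM M.+1 eta x.
  move=> o; suff E : HM M.+1 eta x = HM M eta x by rewrite E in dist *.
  apply: eq_bigr => i _; rewrite !QM_pos ?wx.1//; congr (r ^+ _).
  have [iM|iM] := leqP (x i) M.+1; first by rewrite cntMS// (negPf o) addn0.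
  by rewrite !cnt_gt// ltnW.
set S := \sum_(i < n) _.
have S_le : `|S| <= n%:R * p * ((occ eta M.+1)%:R * HM M eta x).
  apply: (le_trans (ler_norm_sum _ _ _)).
  apply: (@le_trans _ _ (\sum_(i < n) p * ((occ eta M.+1)%:R * HM M eta x))).
    apply: ler_sum => i _; case: ifP => _; last first.
      rewrite mul0r normr0; apply: mulr_ge0; first exact: ltW.
      by apply: mulr_ge0 => //; exact: le_trans h0.
    rewrite -mulrA normrM ger0_norm; last by rewrite subr_ge0 ltW.
    apply: ler_pM => //; first by rewrite subr_ge0 ltW.
      by rewrite lerBlDr lerDl ltW.
    by rewrite ger0_norm ?mulr_ge0// ler_wpM2l.
  by rewrite sumr_const card_ord -[leLHS]mulr_natl mulrA.
rewrite -natr1 mulrDl mulrDl mul1r addrC; apply: (le_trans (ler_normD _ _)).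
apply: lerD.
  apply: (le_trans S_le); apply: ler_wpM2l; first by rewrite mulr_ge0// ltW.
  by rewrite lerDl mulr_ge0.
rewrite /bond -/e -mulrDl normrM.
move: dist dist'; set D := `|_ - _|; case: (occ eta M.+1); case: (occ eta M.+2) => /= d d'.
- rewrite !subrr !mulr0 addr0 normr0 mul0r !mul1r mulr_ge0 ?(ltW p0)//.
  by rewrite addr_ge0//; exact: le_trans h0.
- rewrite !subr0 !mul0r !mulr0 !addr0 !mul1r mulr1 ger0_norm ?(ltW p0) ?(ltW q0)//.
  by rewrite ler_wpM2l// ltW.
- rewrite !subr0 !mul0r !mulr0 !add0r !mul1r mulr1 ger0_norm ?(ltW p0) ?(ltW q0)//.
  by apply: ler_pM; [exact: ltW | exact: normr_ge0 | exact: ltW | exact: d'].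
- by rewrite !mul0r !mulr0 addr0 normr0 mul0r mulr0.
Qed.

Lemma sum_occ_HM_le K n eta (x : {ffun 'I_n -> nat}) (i : 'I_n) : weyl x ->
  \sum_(M < K) (occ eta M.+1)%:R * HM M eta x <= (x i)%:R + (1 - r)^-1.
Proof.
move=> wx.
(* Terms with [M < x i] are bounded by 1 and counted by the minimum; from then on a particle at
   [M.+1] multiplies factor [i] by [r]. The induction carries the telescoped remainder
   [1 - HM K]. *)
suff h : \sum_(M < K) (occ eta M.+1)%:R * HM M eta x <=
    (minn K (x i))%:R + (1 - r)^-1 * (1 - HM K eta x).
  apply: (le_trans h); apply: lerD; first by rewrite ler_nat geq_minr.
  rewrite ler_piMr//; first by rewrite invr_ge0 subr_ge0 ltW.
  by rewrite lerBlDr lerDl HM_ge0.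
elim: K => [|K IH].
  by rewrite big_ord0 addr_ge0// mulr_ge0 ?invr_ge0 ?subr_ge0 ?HM_le1// ltW.
have a0 : 0 < (1 - r)^-1 by rewrite invr_gt0 subr_gt0.
have a1 : (1 - r)^-1 * (1 - r) = 1 by rewrite mulVf// subr_eq0 gt_eqF.
have hS : 0 <= (1 - r)^-1 * (HM K eta x - HM K.+1 eta x).
  by rewrite mulr_ge0 ?subr_ge0 ?HM_leM// ltW.
rewrite big_ord_recr /=; have [Ki|Ki] := ltnP K (x i).
  have : (occ eta K.+1)%:R * HM K eta x <= 1.
    by rewrite mulr_ile1 ?HM_le1 ?HM_ge0// lern1 leq_b1.
  move: IH; rewrite (minn_idPl (ltnW Ki)) (minn_idPl Ki) -natr1; lra.
suff : (occ eta K.+1)%:R * HM K eta x <= (1 - r)^-1 * (HM K eta x - HM K.+1 eta x).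
  move: IH; rewrite (minn_idPr Ki) (minn_idPr (leqW Ki)); lra.
have [ho|_] := boolP (occ eta K.+1); last by rewrite mul0r.
suff h : HM K.+1 eta x <= r * HM K eta x.
  rewrite mul1r -[leLHS]mul1r -[X in X * _]a1 -mulrA; apply: ler_wpM2l; first exact: ltW.
  rewrite mulrBl mul1r lerD2l lerN2; exact: h.
rewrite !(HM_D1 _ _ _ i) mulrA; apply: ler_pM.
- exact/QM_ge0/wx.1.
- by apply: prodr_ge0 => j _; exact/QM_ge0/wx.1.
- by rewrite !QM_pos ?wx.1// cntMS ?(leqW Ki)// ho exprD expr1 mulrC.
- by apply: ler_prod => j _; rewrite QM_ge0 ?QM_leM ?wx.1.
Qed.

(** The bound is uniform in [K] and in the configuration. The factor 2 accounts for the two sums in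
    [dual_error_le], the second being a shift of the first. *)
Lemma sum_dual_error_le K n eta (x : {ffun 'I_n -> nat}) (i : 'I_n) : weyl x ->
  \sum_(M < K) `|dual_error M.+1 eta x| <=
  n.+1%:R * p * (2 * ((x i)%:R + (1 - r)^-1)).
Proof.
move=> wx.
apply: (@le_trans _ _ (\sum_(M < K) n.+1%:R * p *
    ((occ eta M.+1)%:R * HM M eta x + (occ eta M.+2)%:R * HM M.+1 eta x))).
  by apply: ler_sum => M _; exact: dual_error_le.
rewrite -mulr_sumr; apply: ler_wpM2l; first by rewrite mulr_ge0// ltW.
rewrite big_split /= [2]mulr2n mulrDl !mul1r; apply: lerD; first exact: sum_occ_HM_le.
apply: le_trans (sum_occ_HM_le K.+1 eta i wx).
by rewrite big_ord_recl /= lerDr mulr_ge0// HM_ge0.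
Qed.

End TruncatedDuality.

(** * Local functions *)

Section LocalFunctions.
Context {R : realType}.
Implicit Types (eta xi : config) (f g : config -> R).

Lemma nbhs_occ_eq m eta :
  nbhs eta [set xi | forall x, (1 <= x <= m)%N -> occ eta x = occ xi x].
Proof.
have FF : Filter (nbhs eta) := nbhs_filter eta.
elim: m => [|m IH]; first by apply: filterE => xi x; lia.
have h : nbhs eta [set xi : config | xi m = eta m].
  exact: (@proj_continuous nat (fun=> bool) m eta [set eta m] (discrete_set1 _)).
apply: filterS2 IH h => xi h1 h2 x.
rewrite [(x <= m.+1)%N]leq_eqVlt ltnS andb_orr => /orP[/andP[_ /eqP->]|/h1//].
by rewrite /occ /= h2.
Qed.

Lemma local_fun_continuous f : local_fun f -> continuous f.
Proof.
move=> [m hm] eta; have FF : Filter (nbhs eta) := nbhs_filter eta.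
apply: (@cvg_near_cst config R (f eta) f (nbhs eta) FF).
by apply: filterS (nbhs_occ_eq m eta) => xi /hm.
Qed.

Lemma local_asep_gen (p q alpha gamma : R) f : local_fun f ->
  local_fun (asep_gen p q alpha gamma f).
Proof.
move=> [m hm]; exists m.+1 => eta xi h.
have fE : f eta = f xi by apply: hm => x xm; apply: h; lia.
have fF : f (flip eta 1) = f (flip xi 1).
  by apply: hm => x xm; rewrite !occ_flip ?h//; lia.
rewrite !(asep_gen_finite _ _ _ _ _ hm) (h 1%N)// fE fF; congr (_ + _ + _).
apply: eq_big_nat => y ym; rewrite /bond (h y) ?(h y.+1) ?fE; [|lia..].
suff -> : f (exchange eta y y.+1) = f (exchange xi y y.+1) by [].
apply: hm => x xm; rewrite !occ_exchange//; [|lia..].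
by rewrite !h//; lia.
Qed.

(** Composition with [trunc m] makes any function local and, as [m] grows, recovers a continuous one
    pointwise; this yields measurability. *)
Definition trunc (m : nat) eta : config := fun k => if (k < m)%N then eta k else false.

Lemma trunc_cvg eta : trunc m eta @[m --> \oo] --> eta.
Proof.
apply/(@pointwise_cvgP nat bool) => k; apply: cvg_near_cst.
by exists k.+1 => // m /= km; rewrite /trunc km.
Qed.

Lemma local_trunc m f : local_fun (f \o trunc m).
Proof.
exists m => eta xi h; congr f; apply/funext => k; rewrite /trunc.
by case: ifP => // km; exact: (h k.+1).
Qed.

Section Measurability.
Context d (T : measurableType d) (X : T -> config).
Hypothesis mX : forall x, (1 <= x)%N -> measurable [set w | occ (X w) x].

Lemma measurable_local f : local_fun f -> measurable_fun setT (f \o X).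
Proof.
move=> [m hm]; elim: m f hm => [|m IH] f hm.
  suff -> : f \o X = cst (f point) by exact: measurable_cst.
  by apply/funext => w; apply: hm => x; lia.
(* Freezing site [m.+1], whose index is [m], at either value leaves a function of the first [m]
   sites. *)
pose put b eta : config := fun k => if k == m then b else eta k.
have -> : f \o X = fun w => if occ (X w) m.+1 then (f \o put true \o X) w
                            else (f \o put false \o X) w.
  have putE eta : put (occ eta m.+1) eta = eta.
    by apply/funext => k; rewrite /put; case: eqP => [->|].
  by apply/funext => w /=; rewrite -[in LHS](putE (X w)); case: occ.
apply: measurable_fun_ifT.
- by apply: (@measurable_fun_bool _ _ _ _ true); rewrite setTI; exact: mX.
- apply: IH => eta xi h; apply: hm => x xm; rewrite /occ /put.
  by case: eqP => // xm'; apply: h; lia.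
- apply: IH => eta xi h; apply: hm => x xm; rewrite /occ /put.
  by case: eqP => // xm'; apply: h; lia.
Qed.

Lemma measurable_continuous f : continuous f -> measurable_fun setT (f \o X).
Proof.
move=> cf; apply: (@measurable_realfun.measurable_fun_cvg _ _ _ _ (fun m => (f \o trunc m) \o X)).
  by move=> m; exact/measurable_local/local_trunc.
by move=> w _; apply: continuous_cvg; [exact: cf | exact: trunc_cvg].
Qed.

End Measurability.
End LocalFunctions.

(** * Feller semigroups *)

Section Semigroup.
Context {R : realType}.
Implicit Types (f g : config -> R) (eta : config).

Lemma uniform_cvg_near (F : set_system (config -> R)) g e : Filter F ->
  {uniform, F --> g} -> 0 < e -> \forall f \near F, forall eta, `|g eta - f eta| < e.
Proof.
move=> FF Fg e0; apply: Fg; apply/uniform_nbhs; exists [set xy | `|xy.1 - xy.2| < e].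
by split; [exact: entourage_ball (PosNum e0) | move=> f /= h eta; exact: h].
Qed.

Lemma continuousZD (a : R) f g : continuous f -> continuous g ->
  continuous (fun eta => a * f eta + g eta).
Proof.
move=> cf cg eta; have FF : Filter (nbhs eta) := nbhs_filter eta.
by apply: cvgD; [apply: cvgMr; exact: cf | exact: cg].
Qed.

Lemma continuous_config_cst (a : R) : continuous (fun _ : config => a).
Proof. by move=> eta; have FF : Filter (nbhs eta) := nbhs_filter eta; exact: cvg_cst. Qed.

Variable S : R -> (config -> R) -> (config -> R).
Hypothesis fS : feller_semigroup S.

Lemma semigroup0 t eta : 0 <= t -> S t (fun=> 0) eta = 0.
Proof.
move=> t0; have c0 := @continuous_config_cst 0.
have := congr1 (@^~ eta) (fs_linear fS (-1) t0 c0 c0); rewrite /= mulr0 addr0.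
by move=> ->; rewrite mulN1r addNr.
Qed.

Lemma semigroupZ t a f eta : 0 <= t -> continuous f ->
  S t (fun xi => a * f xi) eta = a * S t f eta.
Proof.
move=> t0 cf; have := congr1 (@^~ eta) (fs_linear fS a t0 cf (@continuous_config_cst 0)).
rewrite /= semigroup0// addr0 => <-; congr (S t _ eta); apply/funext => xi; by rewrite addr0.
Qed.

Lemma semigroupD t f g eta : 0 <= t -> continuous f -> continuous g ->
  S t (fun xi => f xi + g xi) eta = S t f eta + S t g eta.
Proof.
move=> t0 cf cg; have := congr1 (@^~ eta) (fs_linear fS 1 t0 cf cg).
rewrite /= mul1r => <-; congr (S t _ eta); apply/funext => xi; by rewrite mul1r.
Qed.

Lemma semigroupB t f g eta : 0 <= t -> continuous f -> continuous g ->
  S t (fun xi => f xi - g xi) eta = S t f eta - S t g eta.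
Proof.
move=> t0 cf cg.
have := congr1 (@^~ eta) (fs_linear fS (-1) t0 cg cf); rewrite /= mulN1r addrC => <-.
by congr (S t _ eta); apply/funext => xi; rewrite mulN1r addrC.
Qed.

Lemma continuous_sum (I : Type) (s : seq I) (f : I -> config -> R) :
  (forall i, continuous (f i)) -> continuous (fun xi => \sum_(i <- s) f i xi).
Proof.
move=> cf; elim: s => [|i s IH].
  under eq_fun do rewrite big_nil; exact: continuous_config_cst.
under eq_fun do rewrite big_cons -[f i _]mul1r.
exact: continuousZD.
Qed.

Lemma semigroup_sum (I : Type) (s : seq I) t (f : I -> config -> R) eta : 0 <= t ->
  (forall i, continuous (f i)) ->
  S t (fun xi => \sum_(i <- s) f i xi) eta = \sum_(i <- s) S t (f i) eta.
Proof.
move=> t0 cf; elim: s => [|i s IH].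
  by under eq_fun do rewrite big_nil; rewrite big_nil semigroup0.
under eq_fun do rewrite big_cons.
by rewrite big_cons semigroupD// ?IH//; exact: continuous_sum.
Qed.

(** Positivity applied to [c + f] and [c - f], with constants preserved. *)
Lemma semigroup_le t f c eta : 0 <= t -> continuous f ->
  (forall xi, `|f xi| <= c) -> `|S t f eta| <= c.
Proof.
move=> t0 cf hf; have c1 := @continuous_config_cst 1.
have S1 : S t (fun=> 1) eta = 1 by rewrite (fs_one fS).
have H (a : R) : (forall xi, 0 <= c + a * f xi) -> 0 <= c + a * S t f eta.
  move=> h; have := congr1 (@^~ eta) (fs_linear fS a t0 cf (@continuous_config_cst c)).
  rewrite /= (_ : S t (fun=> c) eta = c); last first.
    by have := semigroupZ c eta t0 c1; rewrite S1 !mulr1.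
  rewrite addrC => <-; apply: (fs_pos fS) => //.
    exact: continuousZD (@continuous_config_cst c).
  by move=> xi; rewrite addrC.
have := H 1; have := H (-1); rewrite mul1r mulN1r => h1 h2.
have {}h1 : 0 <= c - S t f eta.
  apply: h1 => xi; rewrite mulN1r subr_ge0.
  by apply: le_trans (hf xi); exact: ler_norm.
have {}h2 : 0 <= c + S t f eta.
  apply: h2 => xi; rewrite mul1r -lerBlDr sub0r.
  by apply: le_trans (hf xi); rewrite -normrN; exact: ler_norm.
by rewrite ler_norml; apply/andP; split; lra.
Qed.

Lemma semigroup_near0 g e : continuous g -> 0 < e ->
  exists2 d, 0 < d & forall h, 0 < h -> h < d -> forall eta, `|g eta - S h g eta| <= e.
Proof.
move=> cg e0; have := fs_right_cont fS (lexx 0) cg; rewrite (fs_zero fS cg).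
move=> /uniform_cvg_near => /(_ _ e0) /nbhs_ballP[d /= d0 hd].
exists d => // h h0 hdd eta; apply/ltW/hd => //.
by rewrite /ball /= sub0r normrN gtr0_norm.
Qed.

(** The generator is a right derivative at time 0. The semigroup property moves it to time [t], and
    strong continuity on [g] gives the left increments as well. *)
Lemma semigroup_deriv f g eta t : continuous f -> continuous g -> generates S f g ->
  0 <= t -> has_deriv_ge0 (fun s => S s f eta) t (S t g eta).
Proof.
move=> cf cg gen t0; apply/has_deriv_ge0P => e e0.
have e2 : 0 < e / 2 by rewrite divr_gt0.
have [d1 d10 hd1] := semigroup_near0 cg e2.
have : \forall h \near 0^'+, forall xi, `|g xi - h^-1 * (S h f xi - f xi)| < e / 2.
  exact: uniform_cvg_near _ gen e2.
move=> /nbhs_ballP[d2 /= d20 hd2].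
exists (Num.min d1 d2); first by rewrite lt_min d10.
have key h : 0 < h -> h < d2 -> forall xi, `|g xi - h^-1 * (S h f xi - f xi)| <= e / 2.
  move=> h0 hh xi; apply/ltW/hd2 => //.
  by rewrite /ball /= sub0r normrN gtr0_norm.
have cS h : 0 <= h -> continuous (S h f) by move=> h0; exact: (fs_cont fS).
have cD h : 0 <= h -> continuous (fun xi => h^-1 * (S h f xi - f xi)).
  move=> h0 xi; have FF : Filter (nbhs xi) := nbhs_filter xi.
  by apply: cvgMr; apply: cvgB; [exact: cS | exact: cf].
have cDg h : 0 <= h -> continuous (fun xi => g xi - h^-1 * (S h f xi - f xi)).
  move=> h0 xi; have FF : Filter (nbhs xi) := nbhs_filter xi.
  by apply: cvgB; [exact: cg | exact: cD].
have incr s h : 0 <= s -> 0 < h ->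
    S s (fun xi => h^-1 * (S h f xi - f xi)) eta = (S (s + h) f eta - S s f eta) / h.
  move=> s0 h0; rewrite semigroupZ//; last first.
    move=> xi; have FF : Filter (nbhs xi) := nbhs_filter xi.
    by apply: cvgB; [exact/cS/ltW | exact: cf].
  rewrite semigroupB//; last exact/cS/ltW.
  by rewrite (fs_add fS)// ?(ltW h0)// mulrC.
move=> s s0; rewrite neq_lt lt_min => /orP[st|ts] /andP[sd1 sd2].
  (* Left increment: with [h = t - s], the contraction [S s] factors out and leaves [S h g - g] plus
     the error of the quotient at 0, each at most [e / 2]. *)
  have h0 : 0 < t - s by rewrite subr_gt0.
  rewrite gtr0_norm// in sd1 sd2.
  have -> : (S s f eta - S t f eta) / (s - t) = (S (s + (t - s)) f eta - S s f eta) / (t - s).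
    by rewrite (addrC s (t - s)) subrK; field; rewrite !subr_eq0 gt_eqF// lt_eqF.
  rewrite -incr//.
  have -> : S t g eta = S s (S (t - s) g) eta.
    by rewrite -(fs_add fS)// ?(ltW h0)// (addrC s (t - s)) subrK.
  rewrite -semigroupB//; [|exact/(fs_cont fS)/cg/ltW|exact/cD/ltW].
  have -> : e = e / 2 + e / 2 by field.
  apply: semigroup_le => //.
    move=> xi; have FF : Filter (nbhs xi) := nbhs_filter xi.
    by apply: cvgB; [exact: (fs_cont fS (ltW h0) cg)| exact/cD/ltW].
  move=> xi; rewrite -(subrK (g xi) (S _ g xi)) -addrA.
  apply: (le_trans (ler_normD _ _)); apply: lerD; last exact: key.
  by rewrite distrC; exact: hd1.
have h0 : 0 < s - t by rewrite subr_gt0.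
rewrite distrC gtr0_norm// in sd1 sd2.
have -> : (S s f eta - S t f eta) / (s - t) = (S (t + (s - t)) f eta - S t f eta) / (s - t).
  by rewrite (addrC t (s - t)) subrK.
rewrite -incr// -semigroupB//; [|exact/cD/ltW].
apply: (@le_trans _ _ (e / 2)); last by rewrite ler_pdivrMr// mulr_natr mulr2n lerDl ltW.
by apply: semigroup_le => //; [exact/cDg/ltW | move=> xi; exact: key].
Qed.

Lemma asep_local_generates (p q alpha gamma : R) f :
  (forall f g, continuous f -> continuous g ->
    generates S f g <-> local_closure (asep_gen p q alpha gamma) f g) ->
  local_fun f -> generates S f (asep_gen p q alpha gamma f).
Proof.
move=> gen lf; apply/gen; [exact: local_fun_continuous| | ].
  exact: local_fun_continuous (local_asep_gen _ _ _ _ lf).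
have ucst (h : config -> R) : {uniform, (fun _ : nat => h) k @[k --> \oo] --> h}.
  move=> A /uniform_nbhs[E [entE EA]]; exists 0%N => // k _.
  by apply: EA => y _; exact: entourage_refl.
by exists (fun=> f); split => //; exact: ucst.
Qed.

End Semigroup.

(** * Convergence of the truncated observables *)

Section Limits.
Context {R : realType}.
Variables (p q rho : R).
Hypotheses (q0 : 0 < q) (qp : q < p).
Implicit Types (eta : config).

Let r0 : 0 < q / p. Proof. by rewrite divr_gt0// (lt_trans q0). Qed.
Let r1 : q / p < 1. Proof. by rewrite ltr_pdivrMr ?mul1r// (lt_trans q0). Qed.

Lemma cnt_homo y eta : {homo (fun M => cnt M y eta) : M M' / (M <= M')%N}.
Proof. by apply: homo_leq => [//|M M' M''|M]; [exact: leq_trans | exact: cnt_leM]. Qed.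

Lemma cnt_partial_sum y eta M :
  (\sum_(y <= i < M.+1) ((occ eta i)%:R : R)%:E)%E = (cnt M y eta)%:R%:E.
Proof. by rewrite sumEFin /cnt natr_sum. Qed.

(** A nondecreasing sequence of integers is eventually constant or unbounded; in the second case the
    powers tend to 0, in accordance with the convention in [Q_]. *)
Lemma QM_cvg y eta : (0 < y)%N ->
  QM p q rho M eta y @[M --> \oo] --> Q_ (q / p) y eta.
Proof.
move=> y0; rewrite (_ : (fun M => _) = (fun M => (q / p) ^+ cnt M y eta)); last first.
  by apply/funext => M; rewrite /QM; case: y y0.
have [[B hB]|unb] := pselect (exists B, forall M, (cnt M y eta <= B)%N).
  pose attained c := `[< exists M, cnt M y eta = c >].
  have ex : exists c, attained c by exists (cnt 0 y eta); apply/asboolP; exists 0%N.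
  have ub c : attained c -> (c <= B)%N by move=> /asboolP[M <-].
  have [c /asboolP[M0 M0c] cmax] := ex_maxnP ex ub.
  have cM M : (M0 <= M)%N -> cnt M y eta = c.
    move=> MM; apply/eqP; rewrite eqn_leq -{2}M0c cnt_homo// andbT.
    by apply: cmax; apply/asboolP; exists M.
  have -> : Q_ (q / p) y eta = (q / p) ^+ c.
    rewrite /Q_ (_ : N_ y eta = c%:R%:E); first by rewrite powR_mulrn// ltW.
    apply: cvg_lim => //; apply: cvg_near_cst; exists M0.+1 => // -[|M] //= MM.
    by rewrite cnt_partial_sum cM.
  by apply: cvg_near_cst; exists M0 => // M /= MM; rewrite cM.
have -> : Q_ (q / p) y eta = 0.
  have H B : (B%:R%:E <= (N_ y eta : \bar R))%E.
    have [M BM] : exists M, (B <= cnt M y eta)%N.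
      apply: contrapT => h; apply: unb; exists B => M; rewrite leqNgt.
      by apply/negP => hM; apply: h; exists M; exact: ltnW.
    apply: (@le_trans _ _ (cnt M y eta)%:R%:E); first by rewrite lee_fin ler_nat.
    by rewrite -cnt_partial_sum; apply: nneseries_lim_ge => i _ _; rewrite lee_fin.
  rewrite /Q_; case: (N_ y eta) H => // m H.
  have := H (Num.truncn m).+1; rewrite lee_fin leNgt; case/negP.
  have [m0|m0] := orP (le_total m 0); first by rewrite (le_lt_trans m0).
  by case/andP: (truncn_itv m0).
apply: (@cvg_comp _ _ _ (fun M => cnt M y eta) (fun c => (q / p) ^+ c) _ \oo); last first.
  by apply: cvg_expr; rewrite ger0_norm// ltW.
apply/cvgnyPge => B.
have [M BM] : exists M, (B <= cnt M y eta)%N.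
  apply: contrapT => h; apply: unb; exists B => M; rewrite leqNgt.
  by apply/negP => hM; apply: h; exists M; exact: ltnW.
by exists M => // M' /= MM'; apply: leq_trans BM _; exact: cnt_homo.
Qed.

Lemma HM_cvg n eta (x : {ffun 'I_n -> nat}) : weyl x ->
  HM p q rho M eta x @[M --> \oo] --> H_ (q / p) eta x.
Proof.
move=> [x1 _]; rewrite /HM /H_; elim: (index_enum _) => [|i s IH].
  under eq_fun do rewrite big_nil; rewrite big_nil; exact: cvg_cst.
under eq_fun do rewrite big_cons; rewrite big_cons.
by apply: cvgM => //; exact: QM_cvg.
Qed.

(** [M0] bounds the occupied sites, hence does not depend on [x]: the initial error will be uniform
    over the chamber. *)
Lemma HM_eventually eta : finite_set [set x : nat | (1 <= x)%N /\ occ eta x] ->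
  exists M0, forall M n (x : {ffun 'I_n -> nat}), (M0 <= M)%N -> weyl x ->
    HM p q rho M eta x = H_ (q / p) eta x.
Proof.
move=> fin; have [M0 hM0] : exists M0, forall k, (1 <= k)%N -> occ eta k -> (k <= M0)%N.
  have /finite_seqP[s sE] := fin; exists (\max_(i <- s) i) => k k1 ok.
  have ks : k \in s by have : [set` s] k by rewrite -sE.
  exact: (@leq_bigmax_seq _ s xpredT id).
exists M0 => M n x MM wx; have := @HM_cvg n eta x wx; apply: cvg_unique => //.
apply: cvg_near_cst; exists M0 => // M' /= MM'; apply: eq_bigr => i _.
have y0 := wx.1 i; rewrite /QM; case: (x i) y0 => // y _; congr (_ ^+ _).
suff E M1 : (M0 <= M1)%N -> cnt M1 y.+1 eta = cnt M0 y.+1 eta by rewrite !E.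
elim: M1 => [|M1 IH]; first by rewrite leqn0 => /eqP ->.
rewrite leq_eqVlt => /orP[/eqP<-//|]; rewrite ltnS => M01; rewrite -IH//.
have [yM|yM] := leqP y.+1 M1.+1; last by rewrite !cnt_gt// ltnW.
rewrite cntMS//; have [ok|_] := boolP (occ eta M1.+1); last by rewrite addn0.
by have := hM0 M1.+1 isT ok; lia.
Qed.

End Limits.

(** * Expectations of the process through its semigroup *)

Section Expectation.
Context {R : realType}.
Variables (p q alpha gamma : R) (eta : config).
Context d (T : measurableType d) (P : probability T R) (X : R -> T -> config).
Variable S : R -> (config -> R) -> (config -> R).
Hypothesis fS : feller_semigroup S.
Hypothesis mX : forall (t : R) (x : nat), 0 <= t -> (1 <= x)%N ->
  measurable [set w | occ (X t w) x].
Hypothesis X0 : {ae P, forall w, X 0 w = eta}.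
Hypothesis markov : forall (s t : R) (f : config -> R) (A : set T),
  0 <= s -> 0 <= t -> continuous f -> history X s A ->
  (\int[P]_(w in A) (f (X (s + t) w))%:E = \int[P]_(w in A) (S t f (X s w))%:E)%E.

(** The Markov property at time 0 on the whole space, combined with the almost sure initial
    state. *)
Lemma markov_mean t (f : config -> R) : 0 <= t -> continuous f ->
  (\int[P]_w (f (X t w))%:E = (S t f eta)%:E)%E.
Proof.
move=> t0 cf; have hT : history X 0 setT.
  have [h0 hC _] := smallest_sigma_algebra [set: T] [set A : set T | exists (r : R) (x : nat),
        [/\ 0 <= r <= 0, (1 <= x)%N & A = [set w | occ (X r w) x]]].
  by have := hC _ h0; rewrite setD0.
rewrite -[t in LHS]add0r markov//.
rewrite -[RHS]mule1 -(probability_setT P) -integral_cst//.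
apply: ae_eq_integral => //.
- apply/measurable_realfun.measurable_EFinP; apply: measurable_continuous; last exact: (fs_cont fS).
  by move=> x x1; exact: mX.
- apply: filterS X0 => w -> //.
Qed.

(** The passage from [HM] to [H_] takes place under the law of [X t], by domination by 1, since
    [S t] says nothing about a discontinuous [H_]. *)
Lemma expectation_HM_cvg rho n (x : {ffun 'I_n -> nat}) t : 0 < q -> q < p -> weyl x ->
  0 <= t ->
  exists2 l, S t (fun zeta => HM p q rho M zeta x) eta @[M --> \oo] --> l &
    'E_P[fun w => H_ (q / p) (X t w) x]%E = l%:E.
Proof.
move=> q0 qp wx t0.
have h : (\int[P]_w (HM p q rho M (X t w) x)%:E)%E @[M --> \oo] -->
    (\int[P]_w (H_ (q / p) (X t w) x)%:E)%E.
  apply: (@dominated_cvg _ _ _ _ _ _ _ _ (cst 1%E)) => //.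
  - move=> M; apply/measurable_realfun.measurable_EFinP.
    apply: (@measurable_local _ _ _ (X t) _ (fun zeta => HM p q rho M zeta x)).
      by move=> y y1; exact: mX.
    exact: local_HM.
  - move=> w _; apply: cvg_EFin; first exact: nearW.
    exact: HM_cvg.
  - exact: finite_measure_integrable_cst.
  - by move=> M w _; rewrite /= lee_fin ger0_norm ?HM_le1 ?HM_ge0.
have hS M : (\int[P]_w (HM p q rho M (X t w) x)%:E)%E =
    (S t (fun zeta => HM p q rho M zeta x) eta)%:E.
  exact: (markov_mean t0 (local_fun_continuous (local_HM _ _ _ _ _))).
have {}h : (S t (fun zeta => HM p q rho M zeta x) eta)%:E @[M --> \oo] -->
    (\int[P]_w (H_ (q / p) (X t w) x)%:E)%E.
  by under eq_fun do rewrite -hS.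
have Sle M : `|S t (fun zeta => HM p q rho M zeta x) eta| <= 1.
  apply: (semigroup_le fS) => //; first exact/local_fun_continuous/local_HM.
  by move=> xi; rewrite ger0_norm ?HM_le1 ?HM_ge0.
set I := (\int[P]_w (H_ (q / p) (X t w) x)%:E)%E in h.
have I1 : (I <= 1%:E)%E.
  rewrite -(cvg_lim _ h)//; apply: lime_le; first by apply/cvg_ex; exists I.
  by apply: nearW => M; rewrite lee_fin (le_trans _ (Sle M))// ler_norm.
have I0 : ((-1)%:E <= I)%E.
  rewrite -(cvg_lim _ h)//; apply: lime_ge; first by apply/cvg_ex; exists I.
  by apply: nearW => M; rewrite lee_fin; have := Sle M; rewrite ler_norml => /andP[].
have If : I \is a fin_num.
  by rewrite fin_numE; move: I0 I1; case: (I).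
exists (fine I); last by rewrite unlock fineK.
by move: h; rewrite -(fineK If) => /fine_cvgP[].
Qed.

End Expectation.

(** * Compatibility of averages and of the semigroup with [Delta] and its boundary conditions *)

Section Linearity.
Context {R : realType} (p q kappa : R) (n : nat).
Implicit Types (f g : {ffun 'I_n -> nat} -> R).

Lemma boundary_condB f g : boundary_cond p q kappa f -> boundary_cond p q kappa g ->
  boundary_cond p q kappa (fun x => f x - g x).
Proof.
move=> [f1 f2] [g1 g2]; split=> [i j x wx ji xji|i x wx i0 xi].
  by have := f1 i j x wx ji xji; have := g1 i j x wx ji xji; lra.
by rewrite f2// g2// mulrBr.
Qed.

Lemma boundary_condZ_sum a K (f : nat -> {ffun 'I_n -> nat} -> R) :
  (forall M, boundary_cond p q kappa (f M)) ->
  boundary_cond p q kappa (fun x => a * \sum_(M < K) f M x).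
Proof.
move=> bf; split=> [i j x wx ji xji|i x wx i0 xi].
  rewrite !mulr_sumr -big_split; apply: eq_bigr => M _ /=.
  rewrite [RHS]mulrCA -((bf M).1 i j x wx ji xji); ring.
rewrite mulrCA [kappa * _]mulr_sumr; congr (_ * _).
by apply: eq_bigr => M _; rewrite (bf M).2.
Qed.

Lemma DeltaB f g x : Delta p q (fun y => f y - g y) x = Delta p q f x - Delta p q g x.
Proof. by rewrite -sumrB; apply: eq_bigr => i _; ring. Qed.

Lemma DeltaZ_sum a K (f : nat -> {ffun 'I_n -> nat} -> R) x :
  Delta p q (fun y => a * \sum_(M < K) f M y) x = a * \sum_(M < K) Delta p q (f M) x.
Proof.
rewrite /Delta [in RHS]exchange_big [RHS]mulr_sumr. apply: eq_bigr => i _ /=.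
by rewrite !mulr_sumr -big_split -sumrB; apply: eq_bigr => M _ /=; ring.
Qed.

Variables (S : R -> (config -> R) -> (config -> R)) (fS : feller_semigroup S).
Variables (F : config -> {ffun 'I_n -> nat} -> R).
Hypothesis cF : forall x, continuous (F^~ x).

Lemma semigroup_boundary_cond t eta : 0 <= t ->
  (forall xi, boundary_cond p q kappa (F xi)) ->
  boundary_cond p q kappa (fun x => S t (F^~ x) eta).
Proof.
move=> t0 bF; split=> [i j x wx ji xji|i x wx i0 xi].
  rewrite -!semigroupZ// -semigroupD//; last 2 first.
  - by move=> xi; have FF : Filter (nbhs xi) := nbhs_filter xi; apply: cvgMr; exact: cF.
  - by move=> xi; have FF : Filter (nbhs xi) := nbhs_filter xi; apply: cvgMr; exact: cF.
  by congr (S t _ eta); apply/funext => xi; exact: (bF xi).1.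
rewrite -semigroupZ//; congr (S t _ eta); apply/funext => zeta; exact: (bF zeta).2.
Qed.

Lemma continuous_Delta x : continuous (fun xi => Delta p q (F xi) x).
Proof.
apply: continuous_sum => i xi; have FF : Filter (nbhs xi) := nbhs_filter xi.
by apply: cvgB; [apply: cvgD|]; apply: cvgMr; exact: cF.
Qed.

Lemma semigroup_Delta t eta x : 0 <= t ->
  S t (fun xi => Delta p q (F xi) x) eta = Delta p q (fun y => S t (F^~ y) eta) x.
Proof.
move=> t0; have cZ (a : R) y : continuous (fun xi => a * F xi y).
  by move=> xi; have FF : Filter (nbhs xi) := nbhs_filter xi; apply: cvgMr; exact: cF.
have cD (y z : {ffun 'I_n -> nat}) : continuous (fun xi => p * F xi y + q * F xi z).
  by move=> xi; have FF : Filter (nbhs xi) := nbhs_filter xi; apply: cvgD; exact: cZ.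
rewrite /Delta semigroup_sum//; last first.
  move=> i xi; have FF : Filter (nbhs xi) := nbhs_filter xi.
  by apply: cvgB; [exact: cD | exact: cZ].
by apply: eq_bigr => i _; rewrite semigroupB// semigroupD// !semigroupZ.
Qed.

End Linearity.

(** * Exponential weights *)

Section Weight.
Context {R : realType} (c : R) (n : nat).
Implicit Types x : {ffun 'I_n -> nat}.
Hypothesis c1 : 1 <= c.

Definition weight x : R := \prod_(i < n) expR (c * (x i)%:R).

Let c0 : 0 <= c. Proof. exact: le_trans c1. Qed.

Lemma weight_ge1 x : 1 <= weight x.
Proof.
rewrite /weight; elim/big_ind: _ => // [u v u1 v1|i _].
  by rewrite -[leLHS]mulr1; apply: ler_pM.
by rewrite -expR0 ler_expR mulr_ge0.
Qed.

Lemma weight_ge0 x : 0 <= weight x.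
Proof. exact: le_trans (weight_ge1 x). Qed.

(** [expR (c y) >= 1 + c y >= y] as [c >= 1]: the weight absorbs the linear growth of the duality
    error. *)
Lemma weight_ge x i : (x i)%:R <= weight x.
Proof.
rewrite /weight (bigD1 i)//= -[leLHS]mulr1; apply: ler_pM => //.
  apply: (@le_trans _ _ (c * (x i)%:R)); first by rewrite ler_peMl.
  by apply: le_trans (expR_ge1Dx _); rewrite lerDr.
elim/big_ind: _ => // [u v u1 v1|j _].
  by rewrite -[leLHS]mulr1; apply: ler_pM.
by rewrite -expR0 ler_expR mulr_ge0.
Qed.

Lemma weight_upd x i k : (k <= (x i).+1)%N -> weight (upd x i k) <= expR c * weight x.
Proof.
move=> kx; rewrite /weight (bigD1 i)//= [in leRHS](bigD1 i)//= mulrA updE eqxx.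
rewrite [X in _ * X <= _](_ : _ = \prod_(j < n | j != i) expR (c * (x j)%:R)); last first.
  by apply: eq_bigr => j /negPf ji; rewrite updE ji.
apply: ler_wpM2r; first by apply: prodr_ge0 => j _; exact: expR_ge0.
rewrite -expRD ler_expR -[X in X + _]mulr1 -mulrDr; apply: ler_wpM2l => //.
by rewrite nat1r ler_nat.
Qed.

Lemma weight_homo (c' : R) x : c' <= c ->
  \prod_(i < n) expR (c' * (x i)%:R) <= weight x.
Proof.
move=> cc; apply: ler_prod => i _; rewrite expR_ge0 ler_expR.
exact: ler_wpM2r.
Qed.

End Weight.

(** * Comparison of u with the averaged observables *)

Theorem proposition2p12 (R : realType) (p q alpha gamma rho : R)
  (hq : 0 < q) (hqp : q < p) (halpha : 0 <= alpha) (hgamma : 0 <= gamma)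
  (hLiggett : alpha / p + gamma / q = 1) (hrho : rho = alpha / p)
  (n : nat) (hn : (1 <= n)%N)
  (eta : config) (heta : finite_set [set x : nat | (1 <= x)%N /\ occ eta x])
  (u : R -> {ffun 'I_n -> nat} -> R)
  (h1 : forall (x : {ffun 'I_n -> nat}) (t : R),
     (forall i, (1 <= x i)%N) -> 0 <= t ->
     has_deriv_ge0 (fun s => u s x) t (Delta p q (u t) x))
  (h2 : forall (t : R) (i j : 'I_n) (x : {ffun 'I_n -> nat}),
     0 <= t -> j = i.+1 :> nat -> (forall k, (1 <= x k)%N) ->
     x j = (x i).+1 ->
     p * u t (shift_m x j) + q * u t (shift_p x i) = (p + q) * u t x)
  (h3 : forall (t : R) (i : 'I_n) (x : {ffun 'I_n -> nat}),
     0 <= t -> i = 0%N :> nat -> weyl x -> x i = 1%N ->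
     u t (upd x i 0) = (rho * (q / p) + 1 - rho) * u t x)
  (h4 : forall T : R, 0 < T -> exists c C : R, [/\ 0 < c, 0 < C &
     forall (t : R) (x : {ffun 'I_n -> nat}), 0 <= t <= T -> weyl x ->
       `|u t x| <= C * \prod_(i < n) expR (c * (x i)%:R)])
  (h5 : forall x : {ffun 'I_n -> nat}, weyl x -> u 0 x = H_ (q / p) eta x)
  (d : measure_display) (Omega : measurableType d) (P : probability Omega R)
  (X : R -> Omega -> config)
  (hX : half_line_asep p q alpha gamma eta P X)
  (x : {ffun 'I_n -> nat}) (t : R) (hx : weyl x) (ht : 0 <= t) :
  (u t x)%:E = 'E_P [fun w => H_ (q / p) (X t w) x]%E.
Proof.
have p0 : 0 < p := lt_trans hq hqp.
have r01 : 0 <= q / p <= 1.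
  by rewrite divr_ge0 ?(ltW hq) ?(ltW p0)//= ler_pdivrMr// mul1r ltW.
set kappa := rho * (q / p) + 1 - rho.
have kappa01 : 0 <= kappa <= 1.
  have rho0 : 0 <= rho by rewrite hrho divr_ge0// ltW.
  have rho1 : rho <= 1.
    have : 0 <= gamma / q by rewrite divr_ge0// ltW.
    by rewrite hrho -hLiggett lerDl.
  rewrite /kappa; case/andP: r01; nra.
have [S [fS gen] markov] := hl_markov hX.
(* The horizon [t + 1] is positive even when [t = 0]. *)
have [c0 [C0 [c00 C00 hC]]] := h4 (t + 1) (ltr_wpDl ht ltr01).
have [M0 hM0] := HM_eventually rho hq hqp heta.
(* Large enough to dominate the growth of [u] and for the weight to dominate the coordinates. *)
pose c := Num.max c0 1.
have c1 : 1 <= c by rewrite le_max lexx orbT.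
have c0c : c0 <= c by rewrite le_max lexx.
pose W := @weight R c n.
have W1 (y : {ffun 'I_n -> nat}) : 1 <= W y by exact: weight_ge1.
have W0 (y : {ffun 'I_n -> nat}) : 0 <= W y by exact: weight_ge0.
pose v M (s : R) (y : {ffun 'I_n -> nat}) := S s (fun z => HM p q rho M z y) eta.
(* The levels run from 1 to [K + 1], as the error estimate is available at positive levels. *)
pose V K (s : R) (y : {ffun 'I_n -> nat}) := K.+1%:R^-1 * \sum_(M < K.+1) v M.+1 s y.
pose err M (y : {ffun 'I_n -> nat}) z := dual_error p q alpha gamma rho M z y.
pose e K (s : R) (y : {ffun 'I_n -> nat}) := K.+1%:R^-1 * \sum_(M < K.+1) S s (err M.+1 y) eta.
pose w K (s : R) (y : {ffun 'I_n -> nat}) := u s y - V K s y.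
pose w' K (s : R) (y : {ffun 'I_n -> nat}) := Delta p q (w K s) y - e K s y.
have cH M (y : {ffun 'I_n -> nat}) : continuous (fun z => HM p q rho M z y).
  exact: local_fun_continuous (local_HM _ _ _ _ _).
have cG M (y : {ffun 'I_n -> nat}) : continuous (asep_gen p q alpha gamma (fun z => HM p q rho M z y)).
  exact: local_fun_continuous (local_asep_gen _ _ _ _ (local_HM _ _ _ _ _)).
have cD M (y : {ffun 'I_n -> nat}) : continuous (fun z => Delta p q (HM p q rho M z) y).
  exact: (@continuous_Delta R p q n (fun z => @HM R p q rho M n z) (cH M) y).
have cE M (y : {ffun 'I_n -> nat}) : continuous (err M y).
  by move=> z; have FF : Filter (nbhs z) := nbhs_filter z; apply: cvgB; [exact: cG | exact: cD].
have bc_u s : 0 <= s -> boundary_cond p q kappa (u s).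
  move=> s0; split=> [i j y wy ji yji|i y wy i0 yi]; last exact: h3.
  by apply: h2 => //; exact: wy.1.
have bc_w K s : 0 <= s -> boundary_cond p q kappa (w K s).
  move=> s0; apply: boundary_condB; first exact: bc_u.
  apply: (@boundary_condZ_sum _ _ _ _ _ _ _ (fun M => v M.+1 s)) => M.
  apply: (semigroup_boundary_cond fS (F := fun z => @HM R p q rho M.+1 n z)) => // xi.
  exact: HM_boundary.
have dv M (y : {ffun 'I_n -> nat}) s : 0 <= s ->
    has_deriv_ge0 (v M ^~ y) s (Delta p q (v M s) y + S s (err M y) eta).
  move=> s0.
  have := semigroup_deriv fS (eta := eta) (cH M y) (cG M y) (asep_local_generates gen (local_HM _ _ _ _ _)) s0.
  suff -> : S s (asep_gen p q alpha gamma (fun z => HM p q rho M z y)) eta =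
     Delta p q (v M s) y + S s (err M y) eta by [].
  rewrite -(semigroup_Delta p q fS (F := fun z => @HM R p q rho M n z))// -semigroupD//.
  by congr (S s _ eta); apply/funext => z; rewrite /err /dual_error addrC subrK.
have dw K s (y : {ffun 'I_n -> nat}) : 0 <= s -> weyl y -> has_deriv_ge0 (w K ^~ y) s (w' K s y).
  move=> s0 wy.
  have -> : w' K s y = Delta p q (u s) y + -1 * (K.+1%:R^-1 *
      \sum_(M < K.+1) (Delta p q (v M.+1 s) y + S s (err M.+1 y) eta)).
    rewrite /w' DeltaB (DeltaZ_sum _ _ _ _ (fun M => v M.+1 s)) /e big_split /=; ring.
  have -> : w K ^~ y = fun s => u s y + -1 * V K s y.
    by apply/funext => s'; rewrite mulN1r.
  apply: has_deriv_ge0D; first by apply: h1 => //; exact: wy.1.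
  apply/has_deriv_ge0Z/has_deriv_ge0Z.
  apply: (@has_deriv_ge0_sum _ _ (fun M => v M.+1 ^~ y) s
    (fun M => Delta p q (v M.+1 s) y + S s (err M.+1 y) eta)) => M; exact: dv.
pose a := (1 - q / p)^-1.
have a0 : 0 <= a by rewrite invr_ge0 subr_ge0; case/andP: r01.
pose i0 := Ordinal hn.
(* From [sum_dual_error_le] at the first coordinate, bounding [y i0 + a] by [(1 + a) * W y]. *)
pose C1 := n.+1%:R * p * (2 * (1 + a)).
have C10 : 0 <= C1 by rewrite /C1 !mulr_ge0 ?addr_ge0 ?(ltW p0).
have e_le K s (y : {ffun 'I_n -> nat}) : 0 <= s -> weyl y -> `|e K s y| <= C1 / K.+1%:R * W y.
  move=> s0 wy; rewrite /e normrM ger0_norm ?invr_ge0// mulrAC [leRHS]mulrC ler_wpM2l ?invr_ge0//.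
  rewrite -(semigroup_sum fS _ _ s0 (fun M : 'I_K.+1 => cE M.+1 y)).
  apply: (semigroup_le fS) => //; first by apply: continuous_sum => M; exact: cE.
  move=> z; apply: (le_trans (ler_norm_sum _ _ _)).
  apply: (le_trans (sum_dual_error_le hq hqp hLiggett hrho K.+1 z i0 wy)).
  rewrite /C1 -[leRHS]mulrA; apply: ler_wpM2l; first by rewrite mulr_ge0// ltW.
  rewrite -mulrA; apply: ler_wpM2l => //; rewrite mulrDl mul1r; apply: lerD.
    exact: weight_ge.
  by rewrite ler_peMr.
have V_le K s (y : {ffun 'I_n -> nat}) : 0 <= s -> weyl y -> `|V K s y| <= 1.
  move=> s0 wy; rewrite normrM ger0_norm ?invr_ge0// mulrC ler_pdivrMr// mul1r.
  apply: (le_trans (ler_norm_sum _ _ _)); rewrite -[X in _ <= X%:R]card_ord -sumr_const.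
  apply: ler_sum => M _; apply: (semigroup_le fS) => // z.
  by rewrite ger0_norm ?HM_le1 ?HM_ge0.
have w0_le K (y : {ffun 'I_n -> nat}) : weyl y -> `|w K 0 y| <= M0%:R / K.+1%:R * W y.
  move=> wy; have -> : w K 0 y = K.+1%:R^-1 *
      \sum_(M < K.+1) (H_ (q / p) eta y - HM p q rho M.+1 eta y).
    rewrite /w h5// sumrB mulrBr sumr_const card_ord -[X in _^-1 * X]mulr_natl mulKf//.
    by rewrite /V /v; under eq_bigr => M _ do rewrite (fs_zero fS (cH M.+1 y)).
  rewrite normrM ger0_norm ?invr_ge0// mulrAC mulrC ler_wpM2r ?invr_ge0//.
  apply: (@le_trans _ _ M0%:R); last by rewrite ler_peMr.
  have H01 : 0 <= H_ (q / p) eta y <= 1 by rewrite -(hM0 M0)// HM_ge0 ?HM_le1.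
  apply: (le_trans (ler_norm_sum _ _ _)).
  (* Levels past [M0] contribute nothing; each of the others is a difference of two numbers in
     [[0, 1]]. *)
  apply: (@le_trans _ _ (\sum_(M < K.+1) (M < M0)%:R)).
    apply: ler_sum => M _; have [MM|MM] := ltnP M M0; last first.
      by rewrite hM0 ?subrr ?normr0// leqW.
    have := @HM_ge0 R p q rho hq hqp M.+1 n eta y wy.
    have := @HM_le1 R p q rho hq hqp M.+1 n eta y wy.
    by case/andP: H01; rewrite ler_norml /= => *; apply/andP; split; lra.
  rewrite -natr_sum ler_nat.
  elim: (K.+1) => [|k IH]; first by rewrite big_ord0.
  rewrite big_ord_recr /=; have [kM|kM] := ltnP k M0; last by rewrite addn0.
  rewrite (eq_bigr (fun=> 1%N)) => [|M _]; last by rewrite (ltn_trans (ltn_ord M) kM).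
  by rewrite sum1_card card_ord addn1.
pose E := expR c.
pose L := n.+1%:R * ((p + q) * (E + 1)).
have E1 : 1 <= E by rewrite -expR0 ler_expR (le_trans ler01).
have L0 : 0 <= L.
  by rewrite /L mulr_ge0// mulr_ge0// ?addr_ge0 ?(ltW p0) ?(ltW hq) ?(le_trans ler01 E1).
(* [eps] collects the averaged duality error and the initial error. The a priori constant [C0 + 1]
   bounds [u] and [V] together and is absent from the conclusion. *)
have main K : `|w K t x| <= (C1 + M0%:R) / K.+1%:R * expR ((L + 1) * t) * W x.
  apply: (@weighted_gronwall _ _ [set y | weyl y] W (w K) (w' K) (t + 1) L _ (C0 + 1)) => //.
  - by rewrite divr_ge0// addr_ge0.
  - by move=> s y /andP[s0 _] wy; exact: dw.
  - move=> s b /andP[s0 _] hb y wy; apply: (le_trans (ler_normB _ _)).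
    rewrite mulrDl; apply: lerD.
      apply: (@Delta_le _ p q kappa E b n W (w K s)) => //; rewrite ?(ltW p0) ?(ltW hq)//.
      + by move=> z i; exact: weight_upd.
      + by move=> z i; apply: weight_upd => //; exact: leq_trans (leq_pred _) _.
      + exact: bc_w.
    apply: (le_trans (e_le K s y s0 wy)); rewrite ler_wpM2r// ler_wpM2r ?invr_ge0//.
    by rewrite lerDl.
  - move=> y wy; apply: (le_trans (w0_le K y wy)).
    by rewrite ler_wpM2r// ler_wpM2r ?invr_ge0// lerDr.
  - move=> s y sT wy; have s0 : 0 <= s by case/andP: sT.
    apply: (le_trans (ler_normB _ _)); rewrite mulrDl mul1r; apply: lerD.
      apply: (le_trans (hC s y sT wy)); rewrite ler_wpM2l ?(ltW C00)//.
      exact: weight_homo.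
    exact: le_trans (V_le K s y s0 wy) _.
  - by rewrite ht lerDl ler01.
have [l vl ->] := expectation_HM_cvg fS (hl_meas hX) (hl_init hX) markov rho hq hqp hx ht.
congr (_%:E).
have Vl : V K t x @[K --> \oo] --> l.
  rewrite (_ : (fun K => V K t x) = arithmetic_mean (fun M => v M.+1 t x)).
    by apply: cesaro; rewrite -(cvg_shiftS (fun M => v M t x)) in vl.
  by apply/funext => K; rewrite /arithmetic_mean /V /series /= big_mkord.
have Vu : V K t x @[K --> \oo] --> u t x.
  pose D := (C1 + M0%:R) * expR ((L + 1) * t) * W x.
  have Dh (b : R) : u t x + b * (D * harmonic K) @[K --> \oo] --> u t x.
    rewrite -[X in _ --> X]addr0; apply: cvgD; first exact: cvg_cst.
    rewrite -(mulr0 b) -[X in b * X](mulr0 D).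
    by apply: cvgMr; apply: cvgMr; exact: cvg_harmonic.
  apply: (squeeze_cvgr _ (Dh (-1)) (Dh 1)); apply: nearW => K.
  have := main K; rewrite (_ : _ / _ * _ * W x = D * harmonic K); last first.
    by rewrite /D /harmonic /=; ring.
  by rewrite /w ler_norml => /andP[? ?]; apply/andP; split; lra.
by apply: (cvg_unique _ Vu Vl).
Qed.
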